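(* Let $E,F:\mathcal I\to\mathbb R^{m\times m}$ be sufficiently smooth and let the pair $\{E,F\}$ be regular on $\mathcal I$ with index $\mu\in\mathbb N$ and characteristics $r<m$, $\theta_0=0$ if $\mu=1$, and, for $\mu>1$, $r<m$, $\theta_0\ge\cdots\ge\theta_{\mu-2}>\theta_{\mu-1}=0$. Let $d=r-\sum_{j=0}^{\mu-2}\theta_j$ and let $S_{can}$ be the canonical flow subspace of the DAE. Then: (a) There is a (time-varying) subspace $N_{can}(t)\subset\mathbb R^m$, $t\in\mathcal I$, having on the given interval $\mathcal I$ the dimension $m-d=m-r+\sum_{j=0}^{\mu-2}\theta_j$, such that the decomposition $\mathbb R^m=S_{can}\oplus N_{can}$ holds pointwise on all of $\mathcal I$. Additionally, the canonical projector function $\Pi_{can}$ onto $S_{can}$ along $N_{can}$ is well defined on all of $\mathcal I$. (b) If $a\in\mathcal I$, $G_a\in\mathbb R^{s\times m}$ is such that $s\ge d$ and $\ker G_a=N_{can}(a)$, and if $q$ is sufficiently smooth, then each initial value problem $$Ex'+Fx=q,\qquad G_a(x(a)-x_a)=0,\qquad x_a\in\mathbb R^m,$$ has a unique solution, which features the relation $\Pi_{can}(a)x(a)=\Pi_{can}(a)x_a$ and satisfies, on compact intervals $\mathcal I_a\subseteq\mathcal I$ around $a$, the inequality $$\max_{t\in\mathcal I_a}|x(t)|\le K\Big\{|\Pi_{can}(a)x_a|+\max_{t\in\mathcal I_a}|q(t)|+\sum_{l=1}^{\mu-1}\max_{t\in\mathcal I_a}|q^{(l)}(t)|\Big\},$$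 with a constant $K$ depending only on the pair $\{E,F\}$ and the interval $\mathcal I_a$.
   Context: $\mathcal I\subseteq\mathbb R$ is an interval; $E,F:\mathcal I\to\mathbb R^{m\times m}$ and $q:\mathcal I\to\mathbb R^m$ are sufficiently smooth (as many continuous derivatives as needed); $^*$ denotes transposition; solutions are continuously differentiable. A basis of a time-varying subspace is a matrix function whose columns at each $t$ form a basis of it (empty matrices allowed). Pre-regularity: A pair $\{E,F\}$ of $m\times m$ matrix functions is pre-regular if, with $N(t)=\ker E(t)$, $S(t)=\{z\in\mathbb R^m:F(t)z\in\operatorname{im}E(t)\}$, one has $\operatorname{im}[E(t)\ F(t)]=\mathbb R^m$, $\operatorname{rank}E(t)=r$, $\dim(N(t)\cap S(t))=\theta$ for all $t\in\mathcal I$ with constant integers $r,\theta$. Reduction and regularity: Set $E_0=E,F_0=F,m_0=m$. If $\{E_i,F_i\}$ (size $m_i\times m_i$) is pre-regular with constants $r_i,\theta_i$, choose bases $Y_i$ of $\operatorname{im}E_i$, $Z_i$ of $(\operatorname{im}E_i)^\perp$ and a $C^1$ basis $C_i:\mathcal I\to\mathbb R^{m_i\times r_i}$ of $S_i=\ker Z_i^*F_i$, and put $m_{i+1}=r_i$, $E_{i+1}=Y_i^*E_iC_i$, $F_{i+1}=Y_i^*(F_iC_i+E_iC_i')$; then $\operatorname{rank}E_{i+1}=r_{i+1}=r_i-\theta_i$. A pre-regular pair with $r=r_0<m$ (and the DAE $Ex'+Fx=q$) is regular with index $\mu\ge1$ if $\{E_i,F_i\}$, $i=0,\dots,\mu-1$,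 are well defined and pre-regular, $r_0>\cdots>r_{\mu-1}$, and either $r_{\mu-1}>0$ and $E_\mu$ is pointwise nonsingular, or $r_{\mu-1}=0$. Its characteristics are $r$ and $\theta_0\ge\cdots\ge\theta_{\mu-2}>\theta_{\mu-1}=0$; they do not depend on the chosen bases. Canonical flow subspace: for $\bar t\in\mathcal I$, $S_{can}(\bar t)$ is the set of all $\bar x\in\mathbb R^m$ for which there is a solution $x:(\bar t-\delta,\bar t+\delta)\cap\mathcal I\to\mathbb R^m$ (some $\delta>0$) of $Ex'+Fx=0$ with $x(\bar t)=\bar x$. For a regular pair it has constant dimension $d=r-\sum_{j=0}^{\mu-2}\theta_j$. *)

(* Defs.v *)
From HB Require Import structures.
From mathcomp Require Import all_boot all_order all_algebra.
From mathcomp Require Import all_classical all_reals all_analysis.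

Set Implicit Arguments.
Unset Strict Implicit.
Unset Printing Implicit Defensive.

Import Order.TTheory GRing.Theory Num.Theory.
Import numFieldNormedType.Exports.

Local Open Scope classical_set_scope.
Local Open Scope ring_scope.

(* Intervals may be open, closed or half-open, bounded or not; they are required
   to have interior points, since differential equations are posed on them. *)
Definition proper_interval (R : realType) (J : set R) : Prop :=
  is_interval J /\ interior J !=set0.

(* Differentiation relative to a set J of times: it is one-sided at the
   endpoints that belong to J. *)
Definition diff_quot (R : realType) (V : normedModType R) (f : R -> V) (t : R)
  : R -> V := fun s => (s - t)^-1 *: (f s - f t).

Definition derivable_on (R : realType) (V : normedModType R) (J : set R)
    (f : R -> V) : Prop :=
  forall t, J t -> cvg (diff_quot f t @ within J t^').

Definition derive_on (R : realType) (V : normedModType R) (J : set R)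
    (f : R -> V) : R -> V :=
  fun t => lim (diff_quot f t @ within J t^').

Definition deriven_on (R : realType) (V : normedModType R) (J : set R)
    (l : nat) (f : R -> V) : R -> V := iter l (derive_on J) f.

Definition Ck_on (R : realType) (V : normedModType R) (J : set R) (k : nat)
    (f : R -> V) : Prop :=
  (forall l, (l < k)%N -> derivable_on J (deriven_on J l f)) /\
  (forall l, (l <= k)%N -> {within J, continuous (deriven_on J l f)}).

(* Matrices act on column vectors. *)
Definition im_mx (R : realType) (m n : nat) (A : 'M[R]_(m, n))
  : {vspace 'cV[R]_m} :=
  limg (linfun (mulmx A : 'cV[R]_n -> 'cV[R]_m)).

Definition ker_mx (R : realType) (m n : nat) (A : 'M[R]_(m, n))
  : {vspace 'cV[R]_n} :=
  lker (linfun (mulmx A : 'cV[R]_n -> 'cV[R]_m)).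

Definition preim_mx (R : realType) (m n : nat) (A : 'M[R]_(m, n))
    (V : {vspace 'cV[R]_m}) : {vspace 'cV[R]_n} :=
  (linfun (mulmx A : 'cV[R]_n -> 'cV[R]_m) @^-1: V)%VS.

Definition orthv (R : realType) (m : nat) (V : {vspace 'cV[R]_m})
  : {vspace 'cV[R]_m} :=
  (\bigcap_(w <- vbasis V) ker_mx w^T)%VS.

Definition basis_on (R : realType) (J : set R) (m n : nat)
    (V : R -> {vspace 'cV[R]_m}) (B : R -> 'M[R]_(m, n)) : Prop :=
  forall t, J t -> basis_of (V t) [tuple col j (B t) | j < n].

Definition pre_regular (R : realType) (J : set R) (m : nat)
    (E F : R -> 'M[R]_m) (r theta : nat) : Prop :=
  forall t, J t ->
    [/\ im_mx (row_mx (E t) (F t)) = fullv,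
        \rank (E t) = r
      & \dim (ker_mx (E t) :&: preim_mx (F t) (im_mx (E t)))%VS = theta].

Definition reduction (R : realType) (J : set R) (m r : nat)
    (E F : R -> 'M[R]_m) (E1 F1 : R -> 'M[R]_r) : Prop :=
  exists (Y : R -> 'M[R]_(m, r)) (Z : R -> 'M[R]_(m, m - r))
         (C : R -> 'M[R]_(m, r)),
    [/\ basis_on J (fun t => im_mx (E t)) Y,
        basis_on J (fun t => orthv (im_mx (E t))) Z,
        basis_on J (fun t => ker_mx ((Z t)^T *m F t)) C /\ Ck_on J 1 C
      & forall t, J t ->
          E1 t = (Y t)^T *m E t *m C t /\
          F1 t = (Y t)^T *m (F t *m C t + E t *m derive_on J C t)].

(* reduction_chain J mu E F r theta: the reduction of {E, F}, started with
   r_0 = r, runs through mu pre-regular pairs with r_0 > ... > r_(mu-1) and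
   constants theta 0, ..., theta (mu - 1), and it terminates there. *)
Fixpoint reduction_chain (R : realType) (J : set R) (mu m : nat)
    (E F : R -> 'M[R]_m) (r : nat) (theta : nat -> nat) {struct mu} : Prop :=
  match mu with
  | 0%N => False
  | n.+1 =>
      pre_regular J E F r (theta 0%N) /\
      match n with
      | 0%N =>
          ((0 < r)%N /\
           exists E1 F1 : R -> 'M[R]_r,
             reduction J E F E1 F1 /\ (forall t, J t -> E1 t \in unitmx))
          \/ r = 0%N
      | _.+1 =>
          exists (E1 F1 : R -> 'M[R]_r) (r1 : nat),
            [/\ reduction J E F E1 F1, (r1 < r)%N
              & reduction_chain J n E1 F1 r1 (fun i => theta i.+1)]
      end
  end.

Definition regular_pair (R : realType) (J : set R) (m : nat)
    (E F : R -> 'M[R]_m) (mu r : nat) (theta : nat -> nat) : Prop :=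
  (r < m)%N /\ reduction_chain J mu E F r theta.

Definition dae_solution (R : realType) (J : set R) (m : nat)
    (E F : R -> 'M[R]_m) (q x : R -> 'cV[R]_m) : Prop :=
  Ck_on J 1 x /\
  forall t, J t -> E t *m derive_on J x t + F t *m x t = q t.

Definition canonical_flow (R : realType) (J : set R) (m : nat)
    (E F : R -> 'M[R]_m) (t0 : R) : set 'cV[R]_m :=
  [set x0 | exists2 delta : R, 0 < delta &
     exists2 x : R -> 'cV[R]_m,
       dae_solution (`]t0 - delta, t0 + delta[ `&` J) E F (fun=> 0) x
       & x t0 = x0].

Definition projector_onto_along (R : realType) (m : nat)
    (S N : {vspace 'cV[R]_m}) (P : 'M[R]_m) : Prop :=
  [/\ P *m P = P, im_mx P = S & ker_mx P = N].

(* Maximum over a compact set of times, for continuous f; `|f t| is the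
   maximum norm of the vector f t. *)
Definition max_norm (R : realType) (m : nat) (J : set R) (f : R -> 'cV[R]_m)
  : R := sup [set `|f t| | t in J].

(* Main.v *)
(* A regular pair is reduced to an ordinary differential equation, index by index.
   At each step [im E] and [ker W F] (where [W] annihilates [im E]) are ranges of
   smooth projectors of constant rank, hence have global smooth bases: the linear
   equation [Phi' = (P' P - P P') Phi] transports a basis at one time along [P].
   Writing [x = C z + B q] splits the DAE into an algebraic part and the pair of
   the next step, whose right-hand side involves one more derivative of [q].  The
   given reduction uses bases that are merely C^1 or arbitrary; it stays related to
   the smooth one by a pointwise scaling and a C^1 change of variables.  When the
   leading matrix is invertible, the last derivative of [q] is absorbed in the
   unknown, so that solutions are [x = D v + sum_(l < mu) H_l q^(l)] with
   [v' = A v + sum_(l < mu) B_l q^(l)] and [D] injective.  Then [S_can = im D], any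
   complement can serve as [N_can] (here the orthogonal one), and the estimate is
   the one for linear differential equations. *)
Require Import Defs.
From HB Require Import structures.
From mathcomp Require Import all_boot all_order all_algebra.
From mathcomp Require Import all_classical all_reals all_analysis.
From mathcomp Require Import ring lra zify.
Set Implicit Arguments.
Unset Strict Implicit.
Unset Printing Implicit Defensive.
Import Order.TTheory GRing.Theory Num.Theory.
Import numFieldNormedType.Exports.
Local Open Scope classical_set_scope.
Local Open Scope ring_scope.

(** * Derivatives and smoothness relative to an interval *)

Section RelativeDerivative.
Variable R : realType.
Implicit Types (J : set R) (f g : R -> R) (t l : R).

(** The matrices of the given reduction contain an arbitrary basis [Y] and the derivative of a C^1
    basis, so they need not even be continuous and cannot be differentiated further. A smooth
    reduction is therefore built alongside, and only ranks, surjectivity and invertibility are read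
    off from the given one. Every step costs one order of differentiability, and strictly decreasing
    ranks below [m] force [mu <= r + 1 <= m]: hence the order [m.+1], fixed before the pair. The
    solution formula is proved as an equivalence on every proper subinterval, because the canonical
    flow is defined by local solutions; one direction gives existence, the other uniqueness and the
    description of [S_can]. Derivatives are relations or witnesses, since [derive_on] is a limit
    with no meaning before existence is known. *)

Definition rderiv J f t l : Prop :=
  (fun s => (s - t)^-1 * (f s - f t)) @ within J t^' --> l.

Definition rcont J f : Prop :=
  forall t, J t -> f @ within J (nbhs t) --> f t.

(** By convexity, moving from [t] towards an interior point stays in [J], so [t] is a limit point of
    [J]. Uniqueness of relative derivatives rests on this. *)
Lemma proper_interval_limit J t : proper_interval J -> J t ->
  ProperFilter (within J t^').
Proof.
move=> [iJ [u]]; rewrite /interior /= => Ju Jt.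
have [e /= e0 ballJ] := (nbhs_ballP _ _).1 Ju.
split; last exact: within_filter.
rewrite /within /= /dnbhs /within /= => -/nbhs_ballP [d /= d0 bd].
have [tu|ut] := ltP t u.
  pose s := t + Num.min (d / 2) (u - t).
  have m0 : 0 < Num.min (d / 2) (u - t) by rewrite lt_min divr_gt0 //= subr_gt0.
  have md : Num.min (d / 2) (u - t) <= d / 2 by rewrite ge_min lexx.
  have mu : Num.min (d / 2) (u - t) <= u - t by rewrite ge_min lexx orbT.
  apply: (bd s); rewrite /s.
  - by rewrite /ball /= opprD addNKr normrN gtr0_norm //; lra.
  - by apply/eqP => /(congr1 (fun x => x - t)); lra.
  - apply: (iJ t u) => //; first exact: (ballJ _ (ballxx _ e0)).
    by apply/andP; split; lra.
(* The target [u - e / 2], rather than [u], is strictly left of [t] even when [u = t]. *)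
pose s := t - Num.min (d / 2) (t - (u - e / 2)).
have m0 : 0 < Num.min (d / 2) (t - (u - e / 2)).
  by rewrite lt_min divr_gt0 //=; lra.
have md : Num.min (d / 2) (t - (u - e / 2)) <= d / 2 by rewrite ge_min lexx.
have mu : Num.min (d / 2) (t - (u - e / 2)) <= t - (u - e / 2).
  by rewrite ge_min lexx orbT.
apply: (bd s); rewrite /s.
- by rewrite /ball /= opprD opprK addNKr gtr0_norm //; lra.
- by apply/eqP => /(congr1 (fun x => x - t)); lra.
- apply: (iJ (u - e / 2) t) => //; last by apply/andP; split; lra.
  by apply: ballJ; rewrite /ball /= opprB addrC subrK gtr0_norm; lra.
Qed.

Lemma rderiv_unique J f t l1 l2 : proper_interval J -> J t ->
  rderiv J f t l1 -> rderiv J f t l2 -> l1 = l2.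
Proof.
move=> pJ Jt; have pf := proper_interval_limit pJ Jt.
by move=> h1 h2; apply: (cvg_unique (@Rhausdorff R) h1 h2).
Qed.

Lemma sub_rderiv J' J f t l : J' `<=` J -> rderiv J f t l -> rderiv J' f t l.
Proof.
by move=> sJ; apply: cvg_trans; apply: cvg_app; apply: within_subset.
Qed.

Lemma sub_rcont J' J f : J' `<=` J -> rcont J f -> rcont J' f.
Proof.
move=> sJ h t /sJ Jt; apply: cvg_trans (h t Jt).
by apply: cvg_app; apply: within_subset.
Qed.

Lemma cvg_withinP J f t l : f @ within J (nbhs t) --> l <->
  forall A, nbhs l A -> nbhs t (fun s => J s -> A (f s)).
Proof. by []. Qed.

Lemma cvg_dwithinP J f t l : f @ within J t^' --> l <->
  forall A, nbhs l A -> nbhs t (fun s => s != t -> J s -> A (f s)).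
Proof. by []. Qed.

(** Carathéodory's form: the difference quotient extended by [l] at [t]. It turns the rules for
    derivatives into algebra of limits, with no division. *)
Lemma rderivP J f t l : rderiv J f t l <->
  exists g, [/\ forall s, f s - f t = g s * (s - t),
                g @ within J (nbhs t) --> l & g t = l].
Proof.
split=> [h|[g [fg gl gt]]].
  exists (fun s => if s == t then l else (s - t)^-1 * (f s - f t)).
  split; last by rewrite eqxx.
    move=> s; case: eqVneq => [->|st]; first by rewrite !subrr mulr0.
    by rewrite mulrAC mulVf ?mul1r// subr_eq0.
  apply/cvg_withinP => A lA; have := (cvg_dwithinP _ _ _ _).1 h A lA.
  apply: filterS => s hs Js; case: eqVneq => [_|st]; last exact: hs.
  exact: (nbhs_singleton lA).
apply/cvg_dwithinP => A lA; have := (cvg_withinP _ _ _ _).1 gl A lA.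
apply: filterS => s hs st Js; rewrite fg mulrCA mulVf ?mulr1; first exact: hs.
by rewrite subr_eq0.
Qed.

Lemma rderiv_cvg J f t l : rderiv J f t l -> f @ within J (nbhs t) --> f t.
Proof.
move=> /rderivP [g [fg gl gt]].
have -> : f = (fun s => f t + g s * (s - t)).
  by apply/funext => s; rewrite -fg addrC subrK.
rewrite subrr mulr0 addr0 -[X in _ --> X]addr0 -[X in _ --> _ + X](mulr0 l).
apply: cvgD; first exact: cvg_cst.
apply: cvgM => //; rewrite -(subrr t); apply: cvgB; last exact: cvg_cst.
exact: cvg_within.
Qed.

Lemma eq_rderiv J f g t l : J t -> (forall s, J s -> f s = g s) ->
  rderiv J f t l -> rderiv J g t l.
Proof.
move=> Jt fg h; apply/cvg_dwithinP => A lA.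
have := (cvg_dwithinP _ _ _ _).1 h A lA.
by apply: filterS => s hs st Js; rewrite -!fg//; exact: hs.
Qed.

Lemma eq_rcont J f g : (forall s, J s -> f s = g s) -> rcont J f -> rcont J g.
Proof.
move=> fg h t Jt; apply/cvg_withinP => A lA.
have := (cvg_withinP _ _ _ _).1 (h t Jt) A; rewrite fg// => /(_ lA).
by apply: filterS => s hs Js; rewrite -fg//; exact: hs.
Qed.

Lemma rderiv_cst J c t : rderiv J (fun=> c) t 0.
Proof.
apply/rderivP; exists (fun=> 0); split=> //; last exact: cvg_cst.
by move=> s; rewrite subrr mul0r.
Qed.

Lemma rderivD J f g t a b : rderiv J f t a -> rderiv J g t b ->
  rderiv J (fun s => f s + g s) t (a + b).
Proof.
move=> /rderivP [u [fu cu ut]] /rderivP [v [gv cv vt]]; apply/rderivP.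
exists (fun s => u s + v s); split; last by rewrite ut vt.
  by move=> s; rewrite mulrDl -fu -gv; ring.
exact: cvgD.
Qed.

Lemma rderivM J f g t a b : rderiv J f t a -> rderiv J g t b ->
  rderiv J (fun s => f s * g s) t (a * g t + f t * b).
Proof.
move=> hf hg; have cg := rderiv_cvg hg.
move: hf hg => /rderivP [u [fu cu ut]] /rderivP [v [gv cv vt]]; apply/rderivP.
exists (fun s => u s * g s + f t * v s); split; last by rewrite ut vt.
  by move=> s; rewrite mulrDl -mulrA [g s * _]mulrC mulrA -fu -mulrA -gv; ring.
by apply: cvgD; apply: cvgM => //; exact: cvg_cst.
Qed.

Lemma rderivZ J f t a c : rderiv J f t a -> rderiv J (fun s => c * f s) t (c * a).
Proof.
by move=> h; have := rderivM (rderiv_cst J c t) h; rewrite mul0r add0r.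
Qed.

Lemma rderiv_sum J (I : Type) (r : seq I) (P : pred I) (f : I -> R -> R) t
    (a : I -> R) :
  (forall i, P i -> rderiv J (f i) t (a i)) ->
  rderiv J (fun s => \sum_(i <- r | P i) f i s) t (\sum_(i <- r | P i) a i).
Proof.
move=> h; elim: r => [|i r IH].
  rewrite big_nil; under eq_fun do rewrite big_nil; exact: rderiv_cst.
rewrite big_cons; under eq_fun do rewrite big_cons.
by case: ifP => // Pi; apply: rderivD => //; exact: h.
Qed.

Lemma rderivV J f t a : J t -> (forall s, J s -> f s != 0) -> rderiv J f t a ->
  rderiv J (fun s => (f s)^-1) t (- a / (f t) ^+ 2).
Proof.
move=> Jt f0 hf; have cf := rderiv_cvg hf.
move: hf => /rderivP [u [fu cu ut]].
(* Carathéodory's factorization is required at every [s], while [f] may vanish off [J]; a constant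
   value there makes it trivial. *)
have h : rderiv J (fun s => if s \in J then (f s)^-1 else (f t)^-1) t
    (- a / f t ^+ 2).
  apply/rderivP.
  exists (fun s => if s \in J then - u s * (f t)^-1 * (f s)^-1 else
                   if s == t then - a / f t ^+ 2 else 0); split.
  - move=> s; rewrite (mem_set Jt); case: ifPn => [/set_mem Js|_].
      have fs := f0 s Js; have ft := f0 t Jt.
      have := fu s; set d := s - t => fus.
      have -> : - u s * (f t)^-1 / f s * d =
        - (u s * d) * (f t)^-1 / f s by ring.
      by rewrite -fus; field; rewrite fs ft.
    by rewrite subrr; case: eqP => [->|_]; rewrite ?subrr ?mulr0 ?mul0r.
  - have : (fun s => - u s * (f t)^-1 * (f s)^-1) @ within J (nbhs t) -->
      - a / f t ^+ 2.
      have -> : - a / f t ^+ 2 = - a * (f t)^-1 * (f t)^-1.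
        by rewrite expr2 invfM mulrA.
      apply: cvgM; last by apply: cvgV => //; exact: f0.
      by apply: cvgM; [exact: cvgN|exact: cvg_cst].
    apply: cvg_trans; apply: (@fmap_within_eq _ J) => s Js.
    by rewrite Js.
  - by rewrite (mem_set Jt) ut expr2 invfM mulrA.
by apply: eq_rderiv h => // s Js; rewrite (mem_set Js).
Qed.

Lemma rderiv_interior J f t l : nbhs t J -> rderiv J f t l -> is_derive t 1 f l.
Proof.
move=> nJ /rderivP [g [fg gl gt]]; apply/is_derive1_caratheodory.
exists g; split => //; rewrite /prop_for /continuous_at gt.
move=> A lA; have := (cvg_withinP _ _ _ _).1 gl A lA.
move=> h; suff : nbhs t (fun s => A (g s)) by [].
by apply: filterS2 h nJ => s; exact.
Qed.

Lemma is_derive_rderiv J f t l : is_derive t 1 f l -> rderiv J f t l.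
Proof.
move=> /is_derive1_caratheodory [g [fg cg gt]]; apply/rderivP; exists g; split=> //.
by rewrite -gt; apply: cvg_trans cg; apply: cvg_app; exact: cvg_within.
Qed.

End RelativeDerivative.

(** * Smooth scalar and matrix functions on a set of times *)

Section Smoothness.
Variable R : realType.
Implicit Types (J : set R) (f g : R -> R) (t l : R).

(** The derivative is any witness with the right values on [J], so sums, products and inverses are
    handled by induction on [k] with explicit formulas for the witness. *)
Fixpoint rsmooth J (k : nat) (f : R -> R) {struct k} : Prop :=
  if k is k'.+1 then
    exists g : R -> R, (forall t, J t -> rderiv J f t (g t)) /\ rsmooth J k' g
  else rcont J f.

Lemma rsmooth_rcont J k f : rsmooth J k f -> rcont J f.
Proof. by case: k => // k [g [h _]] t Jt; exact: rderiv_cvg (h t Jt). Qed.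

Lemma rsmoothW J (k l : nat) f : (k <= l)%N -> rsmooth J l f -> rsmooth J k f.
Proof.
elim: k l f => [|k IH] [|l] f //=; first by move=> _ /(@rsmooth_rcont J l.+1).
by move=> kl [g [h hg]]; exists g; split=> //; exact: IH hg.
Qed.

Lemma eq_rsmooth J k f g : (forall s, J s -> f s = g s) -> rsmooth J k f -> rsmooth J k g.
Proof.
case: k => [|k] fg /=; first exact: eq_rcont.
move=> [h [fh hh]]; exists h; split=> // t Jt.
by apply: eq_rderiv (fh t Jt).
Qed.

Lemma sub_rsmooth J' J k f : J' `<=` J -> rsmooth J k f -> rsmooth J' k f.
Proof.
move=> sJ; elim: k f => [|k IH] f /=; first exact: (sub_rcont sJ).
move=> [g [h hg]]; exists g; split; last exact: IH.
by move=> t J't; apply: (sub_rderiv sJ); apply: h; exact: sJ.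
Qed.

Lemma rsmooth_cst J k c : rsmooth J k (fun=> c).
Proof.
elim: k c => [|k IH] c /=; first by move=> t _; exact: cvg_cst.
by exists (fun=> 0); split=> // t _; exact: rderiv_cst.
Qed.

Lemma rsmoothD J k f g : rsmooth J k f -> rsmooth J k g -> rsmooth J k (fun s => f s + g s).
Proof.
elim: k f g => [|k IH] f g /=.
  by move=> hf hg t Jt; apply: cvgD; [exact: hf|exact: hg].
move=> [f' [hf sf]] [g' [hg sg]]; exists (fun s => f' s + g' s).
by split; [move=> t Jt; apply: rderivD; [exact: hf|exact: hg]|exact: IH].
Qed.

Lemma rsmoothM J k f g : rsmooth J k f -> rsmooth J k g -> rsmooth J k (fun s => f s * g s).
Proof.
elim: k f g => [|k IH] f g.
  by move=> hf hg t Jt; apply: cvgM; [exact: hf|exact: hg].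
move=> Sf Sg; have sf := rsmoothW (leqnSn k) Sf; have sg := rsmoothW (leqnSn k) Sg.
move: Sf Sg => [f' [hf sf']] [g' [hg sg']].
exists (fun s => f' s * g s + f s * g' s); split.
  by move=> t Jt; apply: rderivM; [exact: hf|exact: hg].
by apply: rsmoothD; exact: IH.
Qed.

Lemma rsmooth_sum J k (I : Type) (r : seq I) (P : pred I) (f : I -> R -> R) :
  (forall i, P i -> rsmooth J k (f i)) ->
  rsmooth J k (fun s => \sum_(i <- r | P i) f i s).
Proof.
move=> h; elim: r => [|i r IH].
  under eq_fun do rewrite big_nil; exact: rsmooth_cst.
under eq_fun do rewrite big_cons.
by case Pi: (P i) => //; apply: rsmoothD => //; exact: h.
Qed.

Lemma rsmooth_prod J k (I : Type) (r : seq I) (P : pred I) (f : I -> R -> R) :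
  (forall i, P i -> rsmooth J k (f i)) ->
  rsmooth J k (fun s => \prod_(i <- r | P i) f i s).
Proof.
move=> h; elim: r => [|i r IH].
  under eq_fun do rewrite big_nil; exact: rsmooth_cst.
under eq_fun do rewrite big_cons.
by case Pi: (P i) => //; apply: rsmoothM => //; exact: h.
Qed.

Lemma rsmoothV J k f : (forall s, J s -> f s != 0) -> rsmooth J k f ->
  rsmooth J k (fun s => (f s)^-1).
Proof.
move=> f0; elim: k => [|k IH].
  by move=> hf t Jt; apply: cvgV; [exact: f0|exact: hf].
move=> Sf; have sf := IH (rsmoothW (leqnSn k) Sf).
move: Sf => [f' [hf sf']].
exists (fun s => -1 * f' s * ((f s)^-1 * (f s)^-1)); split.
  move=> t Jt; have := rderivV Jt f0 (hf t Jt).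
  by rewrite mulN1r expr2 invfM.
by apply: rsmoothM; apply: rsmoothM => //; exact: rsmooth_cst.
Qed.



Definition mderiv J (a b : nat) (F : R -> 'M[R]_(a, b)) t (L : 'M[R]_(a, b)) :=
  forall i j, rderiv J (fun s => F s i j) t (L i j).

Definition msmooth J k (a b : nat) (F : R -> 'M[R]_(a, b)) :=
  forall i j, rsmooth J k (fun s => F s i j).

Lemma cvg_mxP (T : Type) (G : set_system T) (FG : Filter G) (a b : nat)
    (F : T -> 'M[R]_(a, b)) (L : 'M[R]_(a, b)) :
  F @ G --> L <-> forall i j, (fun s => F s i j) @ G --> L i j.
Proof.
split=> [h i j|h].
  exact: (@cvg_comp _ _ _ F (fun M : 'M[R]_(a, b) => M i j) _ _ _ h
    (@coord_continuous R a b i j L)).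
move=> A [P LP sPA].
have GP : G (fun s => forall i j, P i j (F s i j)).
  apply: filter_forall => i; apply: filter_forall => j; exact: (h i j _ (LP i j)).
suff : G (fun s => A (F s)) by [].
by apply: filterS GP => s hs; exact: sPA.
Qed.

Lemma mderivP J (a b : nat) (F : R -> 'M[R]_(a, b)) t L :
  mderiv J F t L <-> diff_quot F t @ within J t^' --> L.
Proof.
have e i j : (fun s => diff_quot F t s i j) =
    (fun s => (s - t)^-1 * (F s i j - F t i j)).
  by apply/funext => s; rewrite !mxE.
by rewrite cvg_mxP; split=> h i j; have := h i j; rewrite e.
Qed.

Lemma mderiv_derive_on J (a b : nat) (F : R -> 'M[R]_(a, b)) t L :
  proper_interval J -> J t -> mderiv J F t L -> derive_on J F t = L.
Proof.
move=> pJ Jt /mderivP h; have pf := proper_interval_limit pJ Jt.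
by apply: cvg_lim => //; exact: norm_hausdorff.
Qed.

Lemma mderiv_unique J (a b : nat) (F : R -> 'M[R]_(a, b)) t L1 L2 :
  proper_interval J -> J t -> mderiv J F t L1 -> mderiv J F t L2 -> L1 = L2.
Proof.
by move=> pJ Jt h1 h2; apply/matrixP => i j; exact: rderiv_unique (h1 i j) (h2 i j).
Qed.

Lemma sub_mderiv J' J (a b : nat) (F : R -> 'M[R]_(a, b)) t L :
  J' `<=` J -> mderiv J F t L -> mderiv J' F t L.
Proof. by move=> sJ h i j; exact: sub_rderiv sJ (h i j). Qed.

Lemma eq_mderiv J (a b : nat) (F G : R -> 'M[R]_(a, b)) t L : J t ->
  (forall s, J s -> F s = G s) -> mderiv J F t L -> mderiv J G t L.
Proof.
by move=> Jt FG h i j; apply: eq_rderiv (h i j) => // s Js; rewrite FG.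
Qed.

Lemma mderiv_cst J (a b : nat) (M : 'M[R]_(a, b)) t : mderiv J (fun=> M) t 0.
Proof. by move=> i j; rewrite mxE; exact: rderiv_cst. Qed.

Lemma mderivD J (a b : nat) (F G : R -> 'M[R]_(a, b)) t L M :
  mderiv J F t L -> mderiv J G t M -> mderiv J (fun s => F s + G s) t (L + M).
Proof.
move=> hF hG i j; rewrite mxE; under eq_fun do rewrite mxE.
exact: rderivD.
Qed.

Lemma mderivN J (a b : nat) (F : R -> 'M[R]_(a, b)) t L :
  mderiv J F t L -> mderiv J (fun s => - F s) t (- L).
Proof.
move=> hF i j; rewrite mxE -mulN1r; under eq_fun do rewrite mxE -mulN1r.
exact: rderivZ.
Qed.

Lemma mderivB J (a b : nat) (F G : R -> 'M[R]_(a, b)) t L M :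
  mderiv J F t L -> mderiv J G t M -> mderiv J (fun s => F s - G s) t (L - M).
Proof. by move=> hF hG; apply: mderivD => //; exact: mderivN. Qed.

Lemma mderivM J (a b c : nat) (F : R -> 'M[R]_(a, b)) (G : R -> 'M[R]_(b, c)) t
    L M : mderiv J F t L -> mderiv J G t M ->
  mderiv J (fun s => F s *m G s) t (L *m G t + F t *m M).
Proof.
move=> hF hG i j; rewrite !mxE -big_split; under eq_fun do rewrite mxE.
by apply: rderiv_sum => k _; exact: rderivM.
Qed.

Lemma mderiv_sum J (a b : nat) (I : Type) (r : seq I) (P : pred I)
    (F : I -> R -> 'M[R]_(a, b)) t (L : I -> 'M[R]_(a, b)) :
  (forall i, P i -> mderiv J (F i) t (L i)) ->
  mderiv J (fun s => \sum_(i <- r | P i) F i s) t (\sum_(i <- r | P i) L i).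
Proof.
move=> h i j; rewrite summxE; under eq_fun do rewrite summxE.
by apply: rderiv_sum => k Pk; exact: h.
Qed.

Lemma mderivT J (a b : nat) (F : R -> 'M[R]_(a, b)) t L :
  mderiv J F t L -> mderiv J (fun s => (F s)^T) t L^T.
Proof. by move=> h i j; rewrite mxE; under eq_fun do rewrite mxE; exact: h. Qed.

Lemma msmoothW J (k l a b : nat) (F : R -> 'M[R]_(a, b)) :
  (k <= l)%N -> msmooth J l F -> msmooth J k F.
Proof. by move=> kl h i j; exact: rsmoothW kl (h i j). Qed.

Lemma eq_msmooth J k (a b : nat) (F G : R -> 'M[R]_(a, b)) :
  (forall s, J s -> F s = G s) -> msmooth J k F -> msmooth J k G.
Proof. by move=> FG h i j; apply: eq_rsmooth (h i j) => s Js; rewrite FG. Qed.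

Lemma sub_msmooth J' J k (a b : nat) (F : R -> 'M[R]_(a, b)) :
  J' `<=` J -> msmooth J k F -> msmooth J' k F.
Proof. by move=> sJ h i j; exact: sub_rsmooth (h i j). Qed.

Lemma msmooth_der J k (a b : nat) (F : R -> 'M[R]_(a, b)) : msmooth J k.+1 F ->
  exists G, (forall t, J t -> mderiv J F t (G t)) /\ msmooth J k G.
Proof.
move=> h.
have /choice [G hG] : forall ij, exists g, (forall t, J t ->
    rderiv J (fun s => F s ij.1 ij.2) t (g t)) /\ rsmooth J k g.
  by move=> [i j]; exact: h.
exists (fun t => \matrix_(i, j) G (i, j) t); split.
  by move=> t Jt i j; rewrite mxE; exact: (hG (i, j)).1.
by move=> i j; under eq_fun do rewrite mxE; exact: (hG (i, j)).2.
Qed.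

Lemma der_msmooth J k (a b : nat) (F G : R -> 'M[R]_(a, b)) :
  (forall t, J t -> mderiv J F t (G t)) -> msmooth J k G -> msmooth J k.+1 F.
Proof.
move=> h hG i j; exists (fun s => G s i j); split; last exact: hG.
by move=> t Jt; exact: h.
Qed.

Lemma msmooth_derive_on J k (a b : nat) (F : R -> 'M[R]_(a, b)) :
  proper_interval J -> msmooth J k.+1 F ->
  (forall t, J t -> mderiv J F t (derive_on J F t)) /\ msmooth J k (derive_on J F).
Proof.
move=> pJ /msmooth_der [G [h hG]].
have e t : J t -> derive_on J F t = G t.
  by move=> Jt; apply: mderiv_derive_on => //; exact: h.
split; first by move=> t Jt; rewrite e//; exact: h.
by apply: eq_msmooth hG => s Js; rewrite e.
Qed.

Lemma msmooth_cst J k (a b : nat) (M : 'M[R]_(a, b)) : msmooth J k (fun=> M).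
Proof. by move=> i j; exact: rsmooth_cst. Qed.

Lemma msmoothD J k (a b : nat) (F G : R -> 'M[R]_(a, b)) :
  msmooth J k F -> msmooth J k G -> msmooth J k (fun s => F s + G s).
Proof.
by move=> hF hG i j; under eq_fun do rewrite mxE; exact: rsmoothD.
Qed.

Lemma msmoothZ J k (a b : nat) (f : R -> R) (F : R -> 'M[R]_(a, b)) :
  rsmooth J k f -> msmooth J k F -> msmooth J k (fun s => f s *: F s).
Proof.
by move=> hF hG i j; under eq_fun do rewrite mxE; exact: rsmoothM.
Qed.

Lemma msmoothN J k (a b : nat) (F : R -> 'M[R]_(a, b)) :
  msmooth J k F -> msmooth J k (fun s => - F s).
Proof.
move=> hF; under eq_fun do rewrite -scaleN1r.
by apply: msmoothZ => //; exact: rsmooth_cst.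
Qed.

Lemma msmoothB J k (a b : nat) (F G : R -> 'M[R]_(a, b)) :
  msmooth J k F -> msmooth J k G -> msmooth J k (fun s => F s - G s).
Proof. by move=> hF hG; apply: msmoothD => //; exact: msmoothN. Qed.

Lemma msmoothM J k (a b c : nat) (F : R -> 'M[R]_(a, b)) (G : R -> 'M[R]_(b, c)) :
  msmooth J k F -> msmooth J k G -> msmooth J k (fun s => F s *m G s).
Proof.
move=> hF hG i j; under eq_fun do rewrite mxE.
by apply: rsmooth_sum => l _; exact: rsmoothM.
Qed.

Lemma msmooth_sum J k (a b : nat) (I : Type) (r : seq I) (P : pred I)
    (F : I -> R -> 'M[R]_(a, b)) :
  (forall i, P i -> msmooth J k (F i)) ->
  msmooth J k (fun s => \sum_(i <- r | P i) F i s).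
Proof.
move=> h i j; under eq_fun do rewrite summxE.
by apply: rsmooth_sum => l Pl; exact: h.
Qed.

Lemma msmoothT J k (a b : nat) (F : R -> 'M[R]_(a, b)) :
  msmooth J k F -> msmooth J k (fun s => (F s)^T).
Proof. by move=> h i j; under eq_fun do rewrite mxE; exact: h. Qed.

Lemma rsmooth_det J k (a : nat) (F : R -> 'M[R]_a) :
  msmooth J k F -> rsmooth J k (fun s => \det (F s)).
Proof.
move=> h; apply: rsmooth_sum => s _; apply: rsmoothM; first exact: rsmooth_cst.
by apply: rsmooth_prod => i _; exact: h.
Qed.

Lemma msmooth_adj J k (a : nat) (F : R -> 'M[R]_a) :
  msmooth J k F -> msmooth J k (fun s => \adj (F s)).
Proof.
move=> h i j; under eq_fun do rewrite mxE.
apply: rsmoothM; first exact: rsmooth_cst.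
apply: (@rsmooth_det J k a.-1 (fun s => row' j (col' i (F s)))) => u v.
by under eq_fun do rewrite !mxE; exact: h.
Qed.

Lemma msmooth_inv J k (a : nat) (F : R -> 'M[R]_a) :
  (forall s, J s -> F s \in unitmx) ->
  msmooth J k F -> msmooth J k (fun s => invmx (F s)).
Proof.
move=> u h; apply: (@eq_msmooth _ _ _ _ (fun s => (\det (F s))^-1 *: \adj (F s))).
  by move=> s Js; rewrite /invmx u.
apply: msmoothZ; last exact: msmooth_adj.
apply: rsmoothV; last exact: rsmooth_det.
by move=> s /u; rewrite unitmxE unitfE.
Qed.

End Smoothness.

(** * Mean value theorem, primitives and linear differential equations *)

Section MeanValue.
Variable R : realType.
Implicit Types (J : set R) (f g m z w : R -> R) (t l a b c : R).

Lemma rderiv_comp J (phi f : R -> R) t k l :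
  is_derive (f t) 1 phi k -> rderiv J f t l -> rderiv J (fun s => phi (f s)) t (k * l).
Proof.
move=> /is_derive1_caratheodory [h [ph ch ht]] hf.
have cf := rderiv_cvg hf; move: hf => /rderivP [g [fg gl gt]]; apply/rderivP.
exists (fun s => h (f s) * g s); split; last by rewrite ht gt.
  by move=> s; rewrite -mulrA -fg -ph.
apply: cvgM => //; rewrite -ht.
exact: (@cvg_comp _ _ _ f h _ _ _ cf ch).
Qed.

Lemma proper_sub J b c : is_interval J -> J b -> J c -> `[b, c] `<=` J.
Proof.
move=> iJ Jb Jc t /=; rewrite in_itv /= => bc; exact: iJ Jb Jc _ bc.
Qed.

Lemma rcont_within J f : rcont J f <-> {within J, continuous f}.
Proof. by rewrite subspace_continuousP. Qed.

Lemma rderiv_homo J f f' b c : is_interval J -> J b -> J c -> b <= c ->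
  (forall t, b <= t <= c -> rderiv J f t (f' t)) ->
  (forall t, b < t < c -> 0 <= f' t) -> f b <= f c.
Proof.
move=> iJ Jb Jc bc df f0.
(* The intermediate point may be an endpoint, where the sign of [f'] is unknown. The maximum with 0
   agrees with [f'] inside and is nonnegative everywhere. *)
have [||t] := @MVT_segment R f (fun t => Num.max 0 (f' t)) b c bc.
- move=> t tbc; move: (tbc); rewrite in_itv /= => /andP[bt tc].
  have -> : Num.max 0 (f' t) = f' t.
    by apply/max_idPr; apply: f0; rewrite bt.
  apply: (@rderiv_interior _ J); last by apply: df; rewrite !ltW.
  have : \forall s \near t, s \in `]b, c[ by exact: near_in_itvoo.
  apply: filterS => s /=; rewrite in_itv /= => /andP[bs sc].
  by apply: iJ Jb Jc _ _; rewrite !ltW.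
- apply: (@continuous_subspaceW _ _ _ `[b, c]) => //.
  apply/rcont_within => t /=; rewrite in_itv /= => tbc.
  have := rderiv_cvg (df t tbc); apply: cvg_trans; apply: cvg_app.
  by apply: within_subset; exact: proper_sub.
- rewrite -subr_ge0 => _ ->; apply: mulr_ge0; last by rewrite subr_ge0.
  by rewrite le_max lexx.
Qed.

Lemma rderiv0_cst J f b c : is_interval J -> J b -> J c ->
  (forall t, J t -> rderiv J f t 0) -> f b = f c.
Proof.
move=> iJ; wlog bc : b c / b <= c.
  move=> h Jb Jc df; have [/h|/ltW/h] := leP b c; first exact.
  by move=> /(_ Jc Jb df).
move=> Jb Jc df.
have Jt t : b <= t <= c -> J t by move=> tbc; exact: iJ Jb Jc _ tbc.
apply/eqP; rewrite eq_le; apply/andP; split.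
  apply: (@rderiv_homo J f (fun=> 0) b c) => // t /Jt; exact: df.
rewrite -lerN2 -(mulN1r (f b)) -(mulN1r (f c)).
apply: (@rderiv_homo J (fun s => -1 * f s) (fun=> -1 * 0) b c) => //.
by move=> t /Jt Jt2; apply: rderivZ; exact: df.
Qed.

(* Over [m] with [m' = 2 al], the weight [expR `|m|] turns the Picard iteration
   into a contraction of ratio [1/2]. *)
Lemma weighted_bound J (al : R -> R) m z w a c : is_interval J -> J a ->
  (forall t, J t -> 0 <= al t) -> (forall t, J t -> rderiv J m t (2 * al t)) ->
  m a = 0 -> 0 <= c ->
  (forall t, J t -> rderiv J z t (w t)) -> z a = 0 ->
  (forall t, J t -> `|w t| <= c * (al t * expR `|m t|)) ->
  forall t, J t -> `|z t| <= c / 2 * expR `|m t|.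
Proof.
move=> iJ Ja al0 dm ma c0.
suff main z' w' : (forall t, J t -> rderiv J z' t (w' t)) -> z' a = 0 ->
    (forall t, J t -> `|w' t| <= c * (al t * expR `|m t|)) ->
    forall t, J t -> z' t <= c / 2 * expR `|m t|.
  move=> dz za wb t Jt; rewrite ler_norml; apply/andP; split; last exact: main wb t Jt.
  rewrite lerNl -mulN1r.
  apply: (main (fun s => -1 * z s) (fun s => -1 * w s)) => //.
  - by move=> s Js; apply: rderivZ; exact: dz.
  - by rewrite za mulr0.
  - by move=> s Js; rewrite mulN1r normrN; exact: wb.
move=> dz za wb t Jt.
have [at_|ta] := leP a t.
- have Js s : a <= s <= t -> J s by move=> st; exact: iJ Ja Jt _ st.
  have m0 s : a <= s <= t -> 0 <= m s.
    move=> /andP[as_ st]; rewrite -ma.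
    apply: (@rderiv_homo J m (fun u => 2 * al u) a s) => //.
    + by apply: Js; rewrite as_.
    + by move=> u /andP[au us]; apply: dm; apply: Js; rewrite au (le_trans us).
    + move=> u /andP[au us]; apply: mulr_ge0 => //; apply: al0; apply: Js.
      by rewrite (ltW au) (le_trans (ltW us)).
  (* The gap between the bound and [z']. Right of [a], [m] is nonnegative, and [m' = 2 al] makes the
     derivative of the bound dominate [w']. *)
  pose G s := c / 2 * expR (m s) + -1 * z' s.
  have : G a <= G t.
    apply: (@rderiv_homo J G (fun s => c / 2 * (expR (m s) * (2 * al s)) + -1 * w' s)).
    + exact: iJ.
    + exact: Ja.
    + exact: Jt.
    + exact: at_.
    + move=> s st; apply: rderivD; apply: rderivZ; last by apply: dz; exact: Js.
      by apply: (@rderiv_comp _ expR m); apply: dm; exact: Js.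
    + move=> s /andP[as_ st].
      have st' : a <= s <= t by rewrite !ltW.
      have := wb s (Js s st'); rewrite (ger0_norm (m0 s st')).
      by rewrite ler_norml => /andP[_]; lra.
  rewrite /G ma za expR0 ger0_norm; last by apply: m0; rewrite at_ lexx.
  by lra.
- have Js s : t <= s <= a -> J s by move=> st; exact: iJ Jt Ja _ st.
  have ta' := ltW ta.
  have m0 s : t <= s <= a -> m s <= 0.
    move=> /andP[ts sa]; rewrite -ma.
    apply: (@rderiv_homo J m (fun u => 2 * al u) s a) => //.
    + by apply: Js; rewrite ts.
    + by move=> u /andP[su ua]; apply: dm; apply: Js; rewrite ua (le_trans ts).
    + move=> u /andP[su ua]; apply: mulr_ge0 => //; apply: al0; apply: Js.
      by rewrite (ltW ua) (le_trans ts)// ltW.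
  (* Left of [a], [m] is nonpositive and time runs backwards: here [z'] minus the bound increases up
     to its value [- (c / 2)] at [a]. *)
  pose G s := z' s + (- (c / 2)) * expR (-1 * m s).
  have : G t <= G a.
    apply: (@rderiv_homo J G
      (fun s => w' s + - (c / 2) * (expR (-1 * m s) * (-1 * (2 * al s))))).
    + exact: iJ.
    + exact: Jt.
    + exact: Ja.
    + exact: ta'.
    + move=> s st; apply: rderivD; first by apply: dz; exact: Js.
      apply: rderivZ; apply: (@rderiv_comp _ expR (fun s => -1 * m s)).
      by apply: rderivZ; apply: dm; exact: Js.
    + move=> s /andP[ts sa].
      have st' : t <= s <= a by rewrite !ltW.
      have := wb s (Js s st'); rewrite (ler0_norm (m0 s st')).
      by rewrite ler_norml mulN1r => /andP[+ _]; lra.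
  rewrite /G ma za mulr0 expR0 ler0_norm; last by apply: m0; rewrite ta' lexx.
  by rewrite mulN1r; lra.
Qed.

Lemma segment_primitive f b c : b <= c -> rcont `[b, c] f ->
  exists F, forall t, b <= t <= c -> is_derive t 1 F (f t).
Proof.
move=> bc cf.
(* Clamping the argument extends [f] continuously to the whole line, so that two-sided derivatives
   exist even at [b] and [c]. *)
pose h s := f (Num.max b (Num.min s c)).
have clP s : [set` `[b, c]] (Num.max b (Num.min s c)).
  by rewrite /= in_itv /= le_max lexx ge_max bc ge_min lexx orbT.
have ch : continuous h.
  move=> x; rewrite /continuous_at.
  have cc : (fun s => Num.max b (Num.min s c)) @ nbhs x -->
      within `[b, c] (nbhs (Num.max b (Num.min x c))).
    move=> A; rewrite /within /= => hA.
    have cmm : {for x, continuous (fun s => Num.max b (Num.min s c))}.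
      apply: (@continuous_max R _ (cst b) (fun s => Num.min s c)).
        exact: cst_continuous.
      apply: (@continuous_min R _ id (cst c)); last exact: cst_continuous.
      exact: cvg_id.
    have hB : \forall s \near x,
        [set` `[b, c]] (Num.max b (Num.min s c)) -> A (Num.max b (Num.min s c)).
      exact: cmm _ hA.
    suff : \forall s \near x, A (Num.max b (Num.min s c)) by [].
    by apply: filterS hB => s; apply; exact: clP.
  exact: (cvg_comp _ _ cc (cf _ (clP x))).
(* Integrating from [b - 1] makes every point of [[b, c]] interior to the domain
   [[b - 1, c + 1]]. *)
exists (fun x => \int[lebesgue_measure]_(s in `[b - 1, x]) h s).
move=> t /andP[bt tc].
have ->  : f t = h t by rewrite /h; congr f; rewrite (min_idPl tc) (max_idPr bt).
have [||||D E] := @continuous_FTC1_closed R h (b - 1) t (c + 1).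
- lra.
- apply: continuous_compact_integrable; first exact: segment_compact.
  exact: continuous_subspaceT.
- lra.
- exact: ch.
by rewrite -E derive1E; exact/derivableP.
Qed.

End MeanValue.

(** * Primitives on arbitrary intervals and Picard iteration *)

Section LinearODE.
Variable R : realType.
Implicit Types (J : set R) (f g : R -> R) (t a b c : R).

Lemma near_eq_rderiv J f g t l : J t ->
  (\forall s \near t, J s -> f s = g s) -> rderiv J f t l -> rderiv J g t l.
Proof.
move=> Jt fg h; apply/cvg_dwithinP => A lA.
have := (cvg_dwithinP _ _ _ _).1 h A lA.
have ft : f t = g t by exact: (nbhs_singleton fg).
by apply: filterS2 fg => s fg hs st Js; rewrite -ft -fg//; exact: hs.
Qed.

(** Either [J] has a point strictly left of [u], or [u] is the left endpoint of [J]. With its mirror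
    image, this encloses [J] near a given time in a segment of [J], also when the time is an
    endpoint. *)
Lemma interval_lower J u : J u ->
  exists b, [/\ J b, b <= u & forall t, u <= t ->
    \forall s \near t, J s -> b <= s].
Proof.
move=> Ju; have [[b [Jb bu]]|nb] := pselect (exists b, J b /\ b < u).
  exists b; split=> // [|t ut]; first exact: ltW.
  near=> s => _; near: s; apply: lt_le_nbhsr; exact: lt_le_trans ut.
exists u; split=> // t ut; near=> s => Js; rewrite leNgt.
by apply/negP => su; apply: nb; exists s.
Unshelve. all: by end_near. Qed.

Lemma interval_upper J u : J u ->
  exists c, [/\ J c, u <= c & forall t, t <= u ->
    \forall s \near t, J s -> s <= c].
Proof.
move=> Ju; have [[b [Jb bu]]|nb] := pselect (exists b, J b /\ u < b).
  exists b; split=> // [|t ut]; first exact: ltW.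
  near=> s => _; near: s; apply: lt_le_nbhsl; exact: le_lt_trans bu.
exists u; split=> // t ut; near=> s => Js; rewrite leNgt.
by apply/negP => su; apply: nb; exists s.
Unshelve. all: by end_near. Qed.

(** [J] need not be compact, so primitives chosen on segments are glued. Normalized to vanish at
    [a], they agree on overlaps because their difference has derivative 0. *)
Lemma primitive J f a : is_interval J -> J a -> rcont J f ->
  exists F, F a = 0 /\ forall t, J t -> rderiv J F t (f t).
Proof.
move=> iJ Ja cf.
have /choice [P hP] : forall bc : R * R, exists F, J bc.1 -> J bc.2 ->
    bc.1 <= bc.2 -> forall t, bc.1 <= t <= bc.2 -> is_derive t 1 F (f t).
  move=> [b c] /=.
  have [[Jb [Jc bc]]|n] := pselect (J b /\ J c /\ b <= c); last first.
    by exists f => Jb Jc bc; case: n.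
  have [F hF] := segment_primitive bc (sub_rcont (proper_sub iJ Jb Jc) cf).
  by exists F.
(* The segment spanned by [a] and [t] changes with [t]; [agree] replaces it by any fixed larger
   one. *)
pose G t := P (Num.min a t, Num.max a t) t - P (Num.min a t, Num.max a t) a.
have agree b c t : J b -> J c -> b <= a <= c -> b <= t <= c ->
    G t = P (b, c) t - P (b, c) a.
  move=> Jb Jc /andP[ba ac] /andP[bt tc].
  have bc := le_trans ba ac.
  have Jt : J t by apply: iJ Jb Jc _ _; rewrite bt.
  set u := Num.min a t; set v := Num.max a t.
  have Ju : J u by rewrite /u; case: (leP a t).
  have Jv : J v by rewrite /v; case: (leP a t).
  have uv : u <= v by rewrite /u /v; case: (leP a t) => [|/ltW].
  have bu : b <= u by rewrite le_min ba.
  have vc : v <= c by rewrite ge_max ac.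
  have : P (u, v) t + -1 * P (b, c) t = P (u, v) a + -1 * P (b, c) a.
    apply: (@rderiv0_cst R `[u, v] (fun t => P (u, v) t + -1 * P (b, c) t)) => //.
    - exact: interval_is_interval.
    - by rewrite /= in_itv /= /u /v ge_min lexx orbT le_max lexx orbT.
    - by rewrite /= in_itv /= /u /v ge_min lexx le_max lexx.
    move=> s; rewrite /= in_itv /= => /andP[us sv].
    have -> : 0 = f s + -1 * f s by rewrite mulN1r subrr.
    apply: rderivD; last apply: rderivZ; apply: is_derive_rderiv; apply: hP => //=.
      by rewrite us.
    by rewrite (le_trans bu) // (le_trans sv).
  by rewrite /G -/u -/v; lra.
exists G; split; first by rewrite /G subrr.
move=> t Jt.
have [b [Jb ba hb]] := @interval_lower J (Num.min a t) ltac:(by case: (leP a t)).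
have [c [Jc ac hc]] := @interval_upper J (Num.max a t) ltac:(by case: (leP a t)).
move: ba ac; rewrite le_min ge_max => /andP[ba bt] /andP[ac tc].
apply: (@near_eq_rderiv J (fun s => P (b, c) s + - P (b, c) a)) => //.
  have := hb t; rewrite ge_min lexx orbT => /(_ isT).
  have := hc t; rewrite le_max lexx orbT => /(_ isT).
  apply: filterS2 => s cs bs Js.
  by rewrite (agree b c s) // ?ba ?ac// bs// cs.
rewrite -[f t]addr0; apply: rderivD; last exact: rderiv_cst.
by apply: is_derive_rderiv; apply: hP => //=; [exact: le_trans ac|rewrite bt].
Qed.

Lemma mprimitive J (p q : nat) (F : R -> 'M[R]_(p, q)) a :
  is_interval J -> J a -> msmooth J 0 F ->
  exists G, G a = 0 /\ forall t, J t -> mderiv J G t (F t).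
Proof.
move=> iJ Ja cF.
have /choice [G hG] : forall ij, exists G, G a = 0 /\
    forall t, J t -> rderiv J G t (F t ij.1 ij.2).
  by move=> [i j]; apply: primitive => //; exact: cF.
exists (fun t => \matrix_(i, j) G (i, j) t); split.
  by apply/matrixP => i j; rewrite !mxE; exact: (hG (i, j)).1.
by move=> t Jt i j; under eq_fun do rewrite mxE; exact: (hG (i, j)).2.
Qed.

(** It dominates the operator norm for the maximum norm and, as a finite sum of absolute values,
    inherits continuity in time directly. *)
Definition sum_norm (p q : nat) (A : 'M[R]_(p, q)) : R :=
  \sum_i \sum_j `|A i j|.

Lemma sum_norm_ge0 (p q : nat) (A : 'M[R]_(p, q)) : 0 <= sum_norm A.
Proof. by apply: sumr_ge0 => i _; apply: sumr_ge0. Qed.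

Lemma rcont_sum_norm J (p q : nat) (A : R -> 'M[R]_(p, q)) :
  msmooth J 0 A -> rcont J (fun t => sum_norm (A t)).
Proof.
move=> hA; apply: (@rsmooth_sum R J 0) => i _; apply: (@rsmooth_sum R J 0) => j _.
by move=> t Jt; apply: cvg_norm; exact: hA.
Qed.

Lemma row_sum_norm (p q : nat) (A : 'M[R]_(p, q)) i :
  \sum_j `|A i j| <= sum_norm A.
Proof.
rewrite /sum_norm (bigD1 i) //= lerDl.
by apply: sumr_ge0 => k _; apply: sumr_ge0.
Qed.

Lemma mulmx_sum_norm (p q l : nat) (A : 'M[R]_(p, q)) (Z : 'M[R]_(q, l)) B :
  (forall i j, `|Z i j| <= B) -> forall i j, `|(A *m Z) i j| <= sum_norm A * B.
Proof.
move=> hZ i j; rewrite mxE (le_trans (ler_norm_sum _ _ _))//.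
(* For [q = 0] the hypothesis on [Z] is vacuous and [B] may be negative, but both sides are 0. *)
have [/eqP q0|q0] := boolP (q == 0%N).
  subst q; rewrite big_ord0 /sum_norm.
  by under eq_bigr do rewrite big_ord0; rewrite big1// mul0r.
have B0 : 0 <= B.
  have k : 'I_q by case: q q0 {A Z hZ} => // q _; exact: ord0.
  exact: le_trans (hZ k j).
apply: le_trans (ler_wpM2r B0 (row_sum_norm A i)).
rewrite mulr_suml; apply: ler_sum => k _; rewrite normrM.
exact: ler_wpM2l.
Qed.

(** Any left endpoint of the intervals of centre [u k] and radius [2^-1 ^+ k * E] is at most any
    right endpoint, so the supremum of the left endpoints lies in all of them. *)
Lemma geometric_limit (u : nat -> R) E :
  (forall k p, (k <= p)%N -> `|u p - u k| <= 2^-1 ^+ k * E) ->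
  exists l, forall k, `|l - u k| <= 2^-1 ^+ k * E.
Proof.
move=> hu; pose S := [set u k - 2^-1 ^+ k * E | k in [set: nat]].
have S0 : S !=set0 by exists (u 0%N - 2^-1 ^+ 0 * E); exists 0%N.
have uS p : ubound S (u p + 2^-1 ^+ p * E).
  move=> _ [k _ <-].
  have e0 k' : 0 <= 2^-1 ^+ k' * E by apply: le_trans (hu k' k' (leqnn _)).
  have [kp|/ltnW pk] := leqP k p.
    have := hu k p kp; rewrite ler_norml => /andP[+ _].
    by have := e0 p; lra.
  have := hu p k pk; rewrite ler_norml => /andP[_ +].
  by have := e0 k; lra.
have hS : has_sup S by split=> //; exists (u 0%N + 2^-1 ^+ 0 * E); exact: uS.
exists (sup S) => k; rewrite ler_norml; apply/andP; split.
  have : u k - 2^-1 ^+ k * E <= sup S by apply: sup_upper_bound => //; exists k.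
  by lra.
have : sup S <= u k + 2^-1 ^+ k * E by apply: ge_sup.
by lra.
Qed.

Lemma geometric_small E e : 0 < e -> exists k, 2^-1 ^+ k * E <= e :> R.
Proof.
move=> e0.
have : (fun k => 2^-1 ^+ k * E) @ \oo --> (0 : R).
  rewrite -(mul0r E); apply: cvgM; last exact: cvg_cst.
  by apply: cvg_expr; rewrite gtr0_norm // invf_lt1 // ltr1n.
move=> /cvgrPdist_le /(_ e e0) [k _ hk]; exists k.
by have := hk k (leqnn k); rewrite sub0r normrN; apply: le_trans; exact: ler_norm.
Qed.

Lemma geometric_eq0 x E : (forall k, `|x| <= 2^-1 ^+ k * E) -> x = 0 :> R.
Proof.
move=> h; apply/eqP; rewrite -normr_le0; apply/ler_addgt0Pl => e e0.
by have [k hk] := geometric_small E e0; rewrite addr0; apply: le_trans hk.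
Qed.

(** Picard iteration on all of [J] at once: the weight [expR] of [|m|], with [m' = 2 * sum_norm A]
    and [m a = 0], makes every step halve the error although [A] may be unbounded on [J]. *)
Lemma fundamental_matrix J (n : nat) (A : R -> 'M[R]_n) a :
  is_interval J -> J a -> msmooth J 0 A ->
  exists Phi, Phi a = 1%:M /\ forall t, J t -> mderiv J Phi t (A t *m Phi t).
Proof.
move=> iJ Ja cA.
pose al t := sum_norm (A t).
have al0 t : J t -> 0 <= al t by move=> _; exact: sum_norm_ge0.
have [m [ma dm]] : exists m, m a = 0 /\ forall t, J t -> rderiv J m t (2 * al t).
  apply: primitive => //; apply: (@rsmoothM R J 0); first exact: rsmooth_cst.
  exact: rcont_sum_norm.
pose E t := expR `|m t|.
(* A total primitive operator, meaningful only on continuous arguments, lets the iterates be defined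
   before their continuity is proved. *)
have /choice [P hP] : forall G : R -> 'M[R]_n, exists P, msmooth J 0 G ->
    P a = 0 /\ forall t, J t -> mderiv J P t (G t).
  move=> G; have [hG|nG] := pselect (msmooth J 0 G); last by exists G.
  by have [P hP] := mprimitive iJ Ja hG; exists P.
pose X := fix X k := if k is k'.+1 then (fun t => 1%:M + P (fun s => A s *m X k' s) t)
  else (fun=> 1%:M).
have step Y : msmooth J 0 Y -> let Z := fun t => 1%:M + P (fun s => A s *m Y s) t in
    (forall t, J t -> mderiv J Z t (A t *m Y t)) /\ Z a = 1%:M.
  move=> cY /=; have [P0 dP] := hP _ (msmoothM cA cY).
  split=> [t Jt|]; last by rewrite P0 addr0.
  rewrite -[_ *m _]add0r; apply: mderivD; first exact: mderiv_cst.
  exact: dP.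
have cX k : msmooth J 0 (X k).
  elim: k => [|k IH]; first exact: msmooth_cst.
  exact: (msmoothW (leqnSn 0) (der_msmooth (step _ IH).1 (msmoothM cA IH))).
have Xa k : X k a = 1%:M by case: k => // k; exact: (step _ (cX k)).2.
have dX k t : J t -> mderiv J (X k.+1) t (A t *m X k t).
  exact: (step _ (cX k)).1.
have bound (Y Z Y' Z' : R -> 'M[R]_n) c : 0 <= c -> Y a = Z a ->
    (forall t, J t -> mderiv J Y t (A t *m Y' t)) ->
    (forall t, J t -> mderiv J Z t (A t *m Z' t)) ->
    (forall t, J t -> forall i j, `|(Y' t - Z' t) i j| <= c * E t) ->
    forall t, J t -> forall i j, `|(Y t - Z t) i j| <= c / 2 * E t.
  move=> c0 YZ dY dZ hYZ t Jt i j.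
  apply: (@weighted_bound R J al m (fun t => (Y t - Z t) i j)
    (fun t => (A t *m (Y' t - Z' t)) i j) a c) => //.
  - move=> s Js; rewrite mulmxBr.
    by apply: (@mderivB R J n n) => //; [exact: dY|exact: dZ].
  - by rewrite YZ subrr mxE.
  - move=> s Js; rewrite mulrCA.
    by apply: mulmx_sum_norm => u v; exact: hYZ.
have dXX k t : J t -> forall i j,
    `|(X k.+1 t - X k t) i j| <= 2^-1 ^+ k * 2^-1 * E t.
  elim: k t => [|k IH] t Jt i j; last first.
    rewrite exprSr; apply: bound Jt i j => //.
    - by rewrite !Xa.
    - by move=> s Js; apply: dX.
    - by move=> s Js; apply: dX.
    - by move=> s Js u v; exact: IH.
  (* The constant iterate [X 0] is the Picard image of the zero function, so the first difference
     obeys the same contraction, with [c = 1] because the weight is at least 1. *)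
  rewrite expr0; apply: (@bound _ _ (fun=> 1%:M) (fun=> 0)) Jt i j => //.
  - exact: (dX 0%N).
  - by move=> s Js; rewrite mulmx0; exact: mderiv_cst.
  - move=> s Js i j; rewrite subr0 mxE mul1r.
    have : 1 <= E s by rewrite /E -expR0 ler_expR.
    by apply: le_trans; case: eqP; rewrite ?normr1 ?normr0.
clearbody X.
have XX k p t : (k <= p)%N -> J t -> forall i j,
    `|X p t i j - X k t i j| <= 2^-1 ^+ k * E t.
  move=> /subnK <- Jt i j; move: (p - k)%N => {}p.
  (* The sharper telescoping bound is what passes through the induction. *)
  suff : `|X (p + k)%N t i j - X k t i j| <=
      (2^-1 ^+ k - 2^-1 ^+ (p + k)) * E t.
    move/le_trans; apply; rewrite ler_wpM2r ?expR_ge0//.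
    by rewrite gerBl exprn_ge0// invr_ge0.
  elim: p => [|p IH]; first by rewrite add0n !subrr normr0 mul0r.
  have := dXX (p + k)%N t Jt i j; rewrite !mxE addSn => hd.
  have -> : X (p + k).+1 t i j - X k t i j = (X (p + k).+1 t i j -
    X (p + k)%N t i j) + (X (p + k)%N t i j - X k t i j) by ring.
  rewrite (le_trans (ler_normD _ _))// (le_trans (lerD hd IH))//.
  by rewrite -mulrDl exprSr le_eqVlt; apply/orP; left; apply/eqP; congr (_ * _); field.
have /choice [L hL] : forall tij : R * ('I_n * 'I_n), exists l, J tij.1 ->
    forall k, `|l - X k tij.1 tij.2.1 tij.2.2| <= 2^-1 ^+ k * E tij.1.
  move=> [t [i j]] /=; have [Jt|nJ] := pselect (J t); last by exists 0.
  have [|l hl] := @geometric_limit (fun k => X k t i j) (E t).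
    by move=> k p kp; exact: XX.
  by exists l.
pose Y t := \matrix_(i, j) L (t, (i, j)).
have hY k t : J t -> forall i j, `|(Y t - X k t) i j| <= 2^-1 ^+ k * E t.
  by move=> Jt i j; rewrite !mxE; exact: (hL (t, (i, j)) Jt k).
have cY : msmooth J 0 Y.
  move=> i j t Jt; apply/cvgrPdist_le => e e0.
  (* Near [t] one has [E s <= E t + 1], so the two errors at [s] and [t] total at most
     [2^-1 ^+ k * (2 * E t + 1)]. *)
  have [k hk] := @geometric_small (2 * E t + 1) (e / 2) ltac:(by rewrite divr_gt0).
  have cE : rcont J E.
    apply: (@rsmooth_rcont R J 0) => s Js.
    apply: (@cvg_comp _ _ _ (fun s => `|m s|) expR); last exact: continuous_expR.
    by apply: cvg_norm; apply: rderiv_cvg (dm s Js).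
  have /cvgrPdist_le /(_ 1 ltr01) h1 := cE t Jt.
  have /cvgrPdist_le /(_ (e / 2) (divr_gt0 e0 (ltr0Sn _ 1))) h2 := cX k i j t Jt.
  have h3 : within J (nbhs t) J by exact: withinT.
  near=> s.
  have Js : J s by near: s.
  have s1 : `|E t - E s| <= 1 by near: s.
  have s2 : `|X k t i j - X k s i j| <= e / 2 by near: s.
  have := hY k t Jt i j; have := hY k s Js i j; rewrite !mxE.
  set ys := L _; set yt := L _ => hs ht.
  have e1 : 2^-1 ^+ k * E s <= 2^-1 ^+ k * (E t + 1).
    apply: ler_wpM2l; first by rewrite exprn_ge0// invr_ge0.
    by move: s1; rewrite ler_norml => /andP[+ _]; lra.
  have -> : yt - ys = (yt - X k t i j) + (X k t i j - X k s i j) - (ys - X k s i j).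
    by ring.
  rewrite (le_trans (ler_normB _ _))// (le_trans (lerD (ler_normD _ _) (lexx _)))//.
  move: hk; rewrite mulrDr mulr1 mulrA [2^-1 ^+ k * 2]mulrC -mulrA.
  by move: e1; rewrite mulrDr mulr1; lra.
have [dU Ua] := step _ cY; move: dU Ua; set U := fun t => _ + _ => dU Ua.
(* The Picard image [U] of the limit [Y] is as close to [X k.+1] as [Y] is; hence [Y] is a fixed
   point and [U' = A Y = A U]. *)
have UY t : J t -> U t = Y t.
  move=> Jt; apply/matrixP => i j; apply/eqP; rewrite -subr_eq0; apply/eqP.
  apply: (@geometric_eq0 _ (2 * E t)) => k.
  have b1 : `|(U t - X k.+1 t) i j| <= 2^-1 ^+ k / 2 * E t.
    apply: (bound _ _ Y (X k)) Jt i j => //; last exact: hY.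
    - by rewrite Xa.
    - by move=> s Js; exact: dX.
  have b2 := hY k.+1 t Jt i j.
  have subE (M N : 'M[R]_n) : (M - N) i j = M i j - N i j by rewrite !mxE.
  move: b1 b2; rewrite exprSr !subE.
  move: (U t i j) (Y t i j) (X k.+1 t i j) => u y x b1 b2.
  have -> : u - y = (u - x) - (y - x) by ring.
  rewrite (le_trans (ler_normB _ _))// (le_trans (lerD b1 b2))//.
  have : 0 <= 2^-1 ^+ k * E t.
    by rewrite mulr_ge0 ?expR_ge0// exprn_ge0// invr_ge0.
  by lra.
exists U; split=> // t Jt; have := dU t Jt; by rewrite -UY.
Unshelve. all: by end_near. Qed.

End LinearODE.

(** * Linear systems, transport of projectors and norm bounds *)

Section LinearSystems.
Variable R : realType.
Implicit Types (J : set R) (t a b c : R).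

Lemma mderiv0_cst J (p q : nat) (F : R -> 'M[R]_(p, q)) b c :
  is_interval J -> J b -> J c -> (forall t, J t -> mderiv J F t 0) -> F b = F c.
Proof.
move=> iJ Jb Jc dF; apply/matrixP => i j.
apply: (@rderiv0_cst R J (fun s => F s i j)) => // t Jt.
by have := dF t Jt i j; rewrite mxE.
Qed.

(** Bootstrap: [Phi' = A Phi] gives one more order as long as [A] is smooth enough. *)
Lemma linear_system_smooth J k (p q : nat) (A : R -> 'M[R]_p)
    (Phi : R -> 'M[R]_(p, q)) : msmooth J k A ->
  (forall t, J t -> mderiv J Phi t (A t *m Phi t)) -> msmooth J k.+1 Phi.
Proof.
move=> cA dPhi; have c0 : msmooth J 0 Phi.
  by move=> i j t Jt; exact: rderiv_cvg (dPhi t Jt i j).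
suff : forall l, (l <= k.+1)%N -> msmooth J l Phi by exact.
elim=> // l IH lk; apply: (der_msmooth dPhi); apply: msmoothM; first exact: msmoothW cA.
by apply: IH; exact: ltnW.
Qed.

Lemma fundamental_pair J k (n : nat) (A : R -> 'M[R]_n) a :
  is_interval J -> J a -> msmooth J k A ->
  exists Phi Psi : R -> 'M[R]_n,
    [/\ Phi a = 1%:M /\ Psi a = 1%:M,
        forall t, J t -> mderiv J Phi t (A t *m Phi t),
        forall t, J t -> mderiv J Psi t (- (Psi t *m A t)),
        forall t, J t -> Psi t *m Phi t = 1%:M /\ Phi t *m Psi t = 1%:M
      & msmooth J k.+1 Phi /\ msmooth J k.+1 Psi].
Proof.
move=> iJ Ja cA; have cA0 : msmooth J 0 A by exact: msmoothW cA.
have [Phi [Phia dPhi]] := fundamental_matrix iJ Ja cA0.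
have cT : msmooth J k (fun t => - (A t)^T) by apply: msmoothN; exact: msmoothT.
have [Th [Tha dTh]] := fundamental_matrix iJ Ja (msmoothW (leq0n k) cT).
have sTh := linear_system_smooth cT dTh.
have dPsi t : J t -> mderiv J (fun t => (Th t)^T) t (- ((Th t)^T *m A t)).
  move=> Jt; have := mderivT (dTh t Jt).
  by rewrite trmx_mul linearN /= trmxK mulmxN.
have PsiPhi t : J t -> (Th t)^T *m Phi t = 1%:M.
  move=> Jt; have -> : 1%:M = (Th a)^T *m Phi a.
    by rewrite Phia Tha trmx1 mulmx1.
  apply: (@mderiv0_cst J n n (fun s => (Th s)^T *m Phi s)) => // s Js.
  have := mderivM (dPsi s Js) (dPhi s Js).
  by rewrite mulNmx mulmxA addNr.
exists Phi, (fun t => (Th t)^T); split=> //.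
- by rewrite Tha trmx1.
- by move=> t Jt; have e := PsiPhi t Jt; split=> //; exact: mulmx1C.
- by split; [exact: linear_system_smooth cA dPhi|exact: msmoothT].
Qed.

(** In a rank factorization [P = X V], the full-rank factors can be cancelled from
    [X V X V = X V]. *)
Lemma mx_rank_factor (n r : nat) (P : 'M[R]_n) : \rank P = r -> P *m P = P ->
  exists (X : 'M[R]_(n, r)) (V : 'M[R]_(r, n)), P = X *m V /\ V *m X = 1%:M.
Proof.
move=> <- PP; exists (col_base P), (row_base P); rewrite mulmx_base; split=> //.
have /row_freeP [V' hV'] := row_base_free P.
have /row_fullP [X' hX'] := col_base_full P.
have XV : col_base P *m row_base P *m (col_base P *m row_base P) =
    col_base P *m row_base P by rewrite mulmx_base.
move: hV' hX' XV; move: (col_base P) (row_base P) => X V hV' hX'.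
move=> /(congr1 (fun M => X' *m M *m V')).
by rewrite !mulmxA hX' mul1mx -!mulmxA hV' mulmx1.
Qed.

(* Transport along [Phi' = (P' P - P P') Phi] conjugates [P t] to [P a]. *)
Lemma smooth_projector_factor J k (n r : nat) (P : R -> 'M[R]_n) a :
  is_interval J -> J a -> msmooth J k.+1 P ->
  (forall t, J t -> P t *m P t = P t) -> \rank (P a) = r ->
  proper_interval J ->
  exists (X : R -> 'M[R]_(n, r)) (V : R -> 'M[R]_(r, n)),
    [/\ msmooth J k.+1 X, msmooth J k.+1 V
      & forall t, J t -> P t = X t *m V t /\ V t *m X t = 1%:M].
Proof.
move=> iJ Ja sP PP rP pJ.
have [P' [dP sP']] := msmooth_der sP.
have sPk := msmoothW (leqnSn k) sP.
have P'E t : J t -> P' t = P' t *m P t + P t *m P' t.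
  move=> Jt; apply: (mderiv_unique pJ Jt (dP t Jt)).
  by apply: eq_mderiv (mderivM (dP t Jt) (dP t Jt)) => // s Js; exact: PP.
have P'0 t : J t -> P t *m P' t *m P t = 0.
  move=> Jt; have := congr1 (fun M => P t *m M *m P t) (P'E t Jt).
  rewrite mulmxDr mulmxDl !mulmxA (PP t Jt) -!mulmxA (PP t Jt).
  by move/(congr1 (fun M => M - P t *m (P' t *m P t))); rewrite addrK subrr.
have sA : msmooth J k (fun t => P' t *m P t - P t *m P' t).
  by apply: msmoothB; apply: msmoothM.
have [Phi [Psi [[Phia Psia] dPhi dPsi inv [sPhi sPsi]]]] :=
  fundamental_pair iJ Ja sA.
(* With [A = P' P - P P'], the relations [P' = P' P + P P'] and [P P' P = 0] give [A P - P A = P'],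
   so [Psi P Phi] has derivative 0. *)
have conj t : J t -> Psi t *m P t *m Phi t = P a.
  move=> Jt; have -> : P a = Psi a *m P a *m Phi a.
    by rewrite Phia Psia mul1mx mulmx1.
  apply: (@mderiv0_cst J n n (fun s => Psi s *m P s *m Phi s)) => // s Js.
  have := mderivM (mderivM (dPsi s Js) (dP s Js)) (dPhi s Js).
  set D := (X in mderiv _ _ _ X); suff -> : D = 0 by [].
  have h0 := P'0 s Js; have h1 := PP s Js.
  rewrite /D mulmxBr mulNmx !mulmxBl !mulmxBr !mulmxDl.
  rewrite {3}(P'E s Js) mulmxDr mulmxDl !mulmxA.
  have e1 : Psi s *m P' s *m P s *m P s = Psi s *m P' s *m P s.
    by rewrite -!mulmxA h1.
  have e2 : Psi s *m P s *m P' s *m P s = 0.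
    by have := congr1 (fun M => Psi s *m M) h0; rewrite !mulmxA mulmx0.
  have e3 : Psi s *m P s *m P s *m P' s = Psi s *m P s *m P' s.
    by rewrite -[Psi s *m P s *m P s]mulmxA h1.
  rewrite !mulNmx ?mulmxBl e1 e2 e3 mul0mx sub0r subr0 ?subr0 addrA addNr add0r.
  by rewrite subrr.
have [X0 [V0 [PE VX]]] := mx_rank_factor rP (PP a Ja).
exists (fun t => Phi t *m X0), (fun t => V0 *m Psi t); split.
- by apply: msmoothM => //; exact: msmooth_cst.
- by apply: msmoothM => //; exact: msmooth_cst.
move=> t Jt; have [i1 i2] := inv t Jt; split.
  rewrite mulmxA -[Phi t *m X0 *m V0]mulmxA -PE -(conj t Jt) !mulmxA i2 mul1mx.
  by rewrite -mulmxA i2 mulmx1.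
by rewrite mulmxA -[V0 *m Psi t *m Phi t]mulmxA i1 mulmx1.
Qed.

(** Variation of constants, with a primitive of [Psi f]. *)
Lemma linear_ode_solution J (n : nat) (A : R -> 'M[R]_n) (f : R -> 'cV[R]_n)
    a v0 : is_interval J -> J a -> msmooth J 0 A -> msmooth J 0 f ->
  exists v, v a = v0 /\ forall t, J t -> mderiv J v t (A t *m v t + f t).
Proof.
move=> iJ Ja cA cf.
have [Phi [Psi [[Phia Psia] dPhi dPsi inv [sPhi sPsi]]]] :=
  fundamental_pair iJ Ja cA.
have [G [Ga dG]] := mprimitive iJ Ja (msmoothM (msmoothW (leq0n 1) sPsi) cf).
exists (fun t => Phi t *m (v0 + G t)); split.
  by rewrite Phia Ga addr0 mul1mx.
move=> t Jt; have := mderivM (dPhi t Jt) (mderivD (mderiv_cst J v0 t) (dG t Jt)).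
by rewrite add0r mulmxA (inv t Jt).2 mul1mx mulmxA.
Qed.

Lemma mx_norm_leP (p q : nat) (M : 'M[R]_(p, q)) B : 0 <= B ->
  (forall i j, `|M i j| <= B) -> `|M| <= B.
Proof.
move=> B0 h; rewrite /Num.norm /= mx_normrE.
by apply: bigmax_le => // -[i j] _; exact: h.
Qed.

Lemma mx_entry_norm (p q : nat) (M : 'M[R]_(p, q)) i j : `|M i j| <= `|M|.
Proof.
rewrite [leRHS]/Num.norm /= mx_normrE.
exact: (@le_bigmax _ _ _ 0 (fun ij : 'I_p * 'I_q => `|M ij.1 ij.2|) (i, j)).
Qed.

Lemma mulmx_norm (p q l : nat) (A : 'M[R]_(p, q)) (Z : 'M[R]_(q, l)) :
  `|A *m Z| <= sum_norm A * `|Z|.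
Proof.
apply: mx_norm_leP; first by apply: mulr_ge0 => //; exact: sum_norm_ge0.
by apply: mulmx_sum_norm => i j; exact: mx_entry_norm.
Qed.

Lemma segment_bounded J (p q : nat) (A : R -> 'M[R]_(p, q)) b c :
  b <= c -> [set` `[b, c]] `<=` J -> msmooth J 0 A ->
  exists2 K, 0 <= K & forall t, b <= t <= c -> sum_norm (A t) <= K.
Proof.
move=> bc sJ cA.
have cn := rcont_sum_norm (sub_msmooth sJ cA).
have [u ubc hu] := EVT_max bc ((rcont_within _ _).1 cn).
exists (sum_norm (A u)); first exact: sum_norm_ge0.
by move=> t tbc; apply: hu; rewrite in_itv.
Qed.

Lemma mean_value_bound J (p q : nat) (F F' : R -> 'M[R]_(p, q)) b c B :
  is_interval J -> J b -> J c -> 0 <= B ->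
  (forall t, J t -> mderiv J F t (F' t)) ->
  (forall t, J t -> `|F' t| <= B) -> `|F c - F b| <= B * `|c - b|.
Proof.
move=> iJ Jb Jc B0 dF hB.
wlog bc : b c Jb Jc / b <= c.
  move=> h; have [/h|/ltW/h] := leP b c; first exact.
  by move=> /(_ Jc Jb); rewrite distrC [X in _ * X]distrC.
rewrite (ger0_norm (_ : 0 <= c - b)) ?subr_ge0//.
apply: mx_norm_leP => [|i j]; first by rewrite mulr_ge0// subr_ge0.
have hE t : J t -> `|F' t i j| <= B.
  by move=> Jt; exact: le_trans (mx_entry_norm _ i j) (hB t Jt).
have Jt t : b <= t <= c -> J t by move=> tbc; exact: iJ Jb Jc _ tbc.
have did t : rderiv J (fun s => s) t 1.
  by apply: is_derive_rderiv; exact: is_derive_id.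
(* Monotonicity of [B * s - sg * F s i j]; the two signs give the two halves of the absolute
   value. *)
have up (sg : R) : `|sg| = 1 -> sg * (F c i j - F b i j) <= B * (c - b).
  move=> sg1.
  have : B * b + - sg * F b i j <= B * c + - sg * F c i j.
    apply: (@rderiv_homo R J (fun s => B * s + - sg * F s i j)
      (fun s => B * 1 + - sg * F' s i j)) => //.
      move=> t tbc; apply: rderivD; apply: rderivZ; first exact: did.
      by apply: dF; exact: Jt.
    move=> t /andP[bt tc]; have Jt' : J t by apply: Jt; rewrite !ltW.
    have : `|sg * F' t i j| <= B by rewrite normrM sg1 mul1r hE.
    by rewrite ler_norml => /andP[_]; lra.
  by lra.
rewrite !mxE ler_norml; apply/andP; split.
  by have := up (-1); rewrite normrN1 => /(_ erefl); lra.
by have := up 1; rewrite normr1 => /(_ erefl); lra.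
Qed.

End LinearSystems.

(** * Linear algebra of the reduction step *)

Section LinearAlgebra.
Variable R : realType.

Lemma mem_im_mx (m n : nat) (A : 'M[R]_(m, n)) v :
  v \in im_mx A <-> exists w, v = A *m w.
Proof.
split=> [/memv_imgP [w _ ->]|[w ->]]; first by exists w; rewrite lfunE.
by apply/memv_imgP; exists w; [exact: memvf|rewrite lfunE].
Qed.

Lemma mem_ker_mx (m n : nat) (A : 'M[R]_(m, n)) v :
  v \in ker_mx A <-> A *m v = 0.
Proof. by rewrite memv_ker lfunE /=; split=> [/eqP|->]. Qed.

Lemma mem_preim_mx (m n : nat) (A : 'M[R]_(m, n)) V v :
  (v \in preim_mx A V) = (A *m v \in V).
Proof. by rewrite -memv_preim lfunE. Qed.

Lemma mem_orthv (m : nat) (V : {vspace 'cV[R]_m}) v :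
  v \in orthv V <-> forall w, w \in V -> w^T *m v = 0.
Proof.
have gen (s : seq 'cV[R]_m) : v \in (\bigcap_(w <- s) ker_mx w^T)%VS <->
    forall w, w \in s -> w^T *m v = 0.
  elim: s => [|u s IH]; first by rewrite big_nil memvf.
  rewrite big_cons memv_cap; split.
    by move=> /andP[/mem_ker_mx hu /IH hs] w; rewrite inE => /orP[/eqP ->|/hs].
  move=> h; apply/andP; split; first by apply/mem_ker_mx/h; rewrite mem_head.
  by apply/IH => w ws; apply: h; rewrite inE ws orbT.
rewrite /orthv gen; split=> h w wV; last exact: h (vbasis_mem wV).
rewrite (coord_vbasis wV) linear_sum mulmx_suml big1 // => i _.
by rewrite linearZ -scalemxAl h ?scaler0 // mem_nth// size_tuple.
Qed.

Lemma mulmx_sum_col (m n : nat) (A : 'M[R]_(m, n)) (w : 'cV[R]_n) :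
  A *m w = \sum_i w i 0 *: col i A.
Proof.
apply/matrixP => i j; rewrite !mxE summxE; apply: eq_bigr => k _.
by rewrite !mxE ord1 mulrC.
Qed.

Lemma nth_cols (m n : nat) (A : 'M[R]_(m, n)) (i : 'I_n) :
  [tuple col j A | j < n]`_i = col i A.
Proof. by rewrite -tnth_nth tnth_mktuple. Qed.

Lemma basis_cols (m n : nat) (V : {vspace 'cV[R]_m}) (A : 'M[R]_(m, n)) :
  basis_of V [tuple col j A | j < n] ->
  (forall v, v \in V <-> exists w, v = A *m w) /\
  (forall w : 'cV_n, A *m w = 0 -> w = 0).
Proof.
move=> bA; split.
  move=> v; split=> [vV|[w ->]].
    exists (\col_i coord [tuple col j A | j < n] i v).
    rewrite mulmx_sum_col {1}(coord_span (_ : v \in <<[tuple col j A | j < n]>>%VS)).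
      by apply: eq_bigr => i _; rewrite mxE nth_cols.
    by rewrite (span_basis bA).
  rewrite mulmx_sum_col; apply: memv_suml => i _; apply: memvZ.
  by apply: (basis_mem bA); apply/tnthP; exists i; rewrite tnth_mktuple.
move=> w Aw; have /freeP fA := basis_free bA.
apply/colP => i; rewrite mxE; apply: (fA (fun i => w i 0)).
by under eq_bigr do rewrite nth_cols; rewrite -mulmx_sum_col.
Qed.

Lemma lift_cols (m n p : nat) (A : 'M[R]_(m, n)) (X : 'M[R]_(m, p)) :
  (forall w : 'cV_p, exists u, X *m w = A *m u) -> exists U, X = A *m U.
Proof.
move=> h; have /choice [u hu] : forall j, exists u : 'cV_n, col j X = A *m u.
  by move=> j; have [u] := h (delta_mx j 0); rewrite -colE => e; exists u.
exists (\matrix_(i, j) u j i 0); apply/matrixP => i j.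
have := congr1 (fun M : 'cV_m => M i 0) (hu j); rewrite !mxE => ->.
by apply: eq_bigr => k _; rewrite mxE.
Qed.

(** Over the reals, the diagonal entries of [X^T X] are sums of squares. *)
Lemma gram_eq0 (m n : nat) (X : 'M[R]_(m, n)) : X^T *m X = 0 -> X = 0.
Proof.
move=> h; apply/matrixP => i j; rewrite mxE.
have : (X^T *m X) j j = 0 by rewrite h mxE.
rewrite mxE => /eqP; rewrite psumr_eq0; last first.
  by move=> k _; rewrite mxE -expr2 sqr_ge0.
by move=> /allP /(_ i (mem_index_enum _)); rewrite mxE mulf_eq0 orbb => /eqP.
Qed.

Lemma gram_unit (m n : nat) (X : 'M[R]_(m, n)) :
  (forall w : 'cV_n, X *m w = 0 -> w = 0) -> X^T *m X \in unitmx.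
Proof.
move=> h; rewrite unitmxE unitfE; apply/negP => /det0P [v v0 vX].
have : X *m v^T = 0.
  by apply: gram_eq0; rewrite trmx_mul trmxK mulmxA -[v *m _ *m _]mulmxA vX mul0mx.
by move=> /h /(congr1 trmx); rewrite trmxK trmx0 => v00; rewrite v00 eqxx in v0.
Qed.

Lemma inj_of_linv (m n : nat) (X : 'M[R]_(m, n)) (V : 'M[R]_(n, m)) :
  V *m X = 1%:M -> forall w : 'cV_n, X *m w = 0 -> w = 0.
Proof. by move=> VX w Xw; rewrite -[w]mul1mx -VX -mulmxA Xw mulmx0. Qed.

Lemma dim_im_inj (m n : nat) (X : 'M[R]_(m, n)) :
  (forall w : 'cV_n, X *m w = 0 -> w = 0) -> \dim (im_mx X) = n.
Proof.
move=> h; have k0 : lker (linfun (mulmx X : 'cV[R]_n -> 'cV[R]_m)) = 0%VS.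
  apply/eqP; rewrite -subv0; apply/subvP => w; rewrite memv0.
  by move=> /mem_ker_mx /h ->.
have := limg_ker_dim (linfun (mulmx X : 'cV[R]_n -> 'cV[R]_m)) fullv.
by rewrite k0 capv0 dimv0 add0n dimvf dim_matrix mulr1.
Qed.

Lemma eq_im_mx (m n p : nat) (A : 'M[R]_(m, n)) (B : 'M[R]_(m, p)) U V :
  A = B *m U -> B = A *m V -> im_mx A = im_mx B.
Proof.
move=> AB BA; apply/vspaceP => v; apply/idP/idP => /mem_im_mx [w ->];
  apply/mem_im_mx.
  by exists (U *m w); rewrite mulmxA -AB.
by exists (V *m w); rewrite mulmxA -BA.
Qed.

Lemma dim_im_mx (m n : nat) (A : 'M[R]_(m, n)) : \dim (im_mx A) = \rank A.
Proof.
have /row_freeP [V' hV'] := row_base_free A.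
have /row_fullP [X' hX'] := col_base_full A.
have e : im_mx A = im_mx (col_base A).
  apply: (eq_im_mx (U := row_base A) (V := V')); first by rewrite mulmx_base.
  rewrite -[X in _ = X *m V'](mulmx_base A).
  move: hV'; move: (col_base A) (row_base A) => X V VV'.
  by rewrite -mulmxA VV' mulmx1.
by rewrite e; apply: dim_im_inj; exact: inj_of_linv hX'.
Qed.

Lemma rank_injr (m n p : nat) (Y : 'M[R]_(m, n)) (A : 'M[R]_(n, p)) V :
  V *m Y = 1%:M -> \rank (Y *m A) = \rank A.
Proof.
move=> VY; apply/eqP; rewrite eqn_leq mxrankM_maxr /=.
by rewrite -{1}[A]mul1mx -VY -mulmxA mxrankM_maxr.
Qed.

Lemma rank_compl_proj (n : nat) (P : 'M[R]_n) : P *m P = P ->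
  \rank (1%:M - P) = (n - \rank P)%N.
Proof.
move=> PP; rewrite -mxrank_ker; apply/eqP; rewrite eqn_leq.
apply/andP; split; apply: mxrankS.
  by apply/sub_kermxP; rewrite mulmxBl mul1mx PP subrr.
apply/submxP; exists (kermx P); rewrite mulmxBr mulmx1.
by rewrite (mulmx_ker P) subr0.
Qed.

(* The rank-[r] projector onto [im E] as a weighted mean, over the choices [f] of
   [r] columns, of the Gram projectors [X (X^T X)^-1 X^T]; the weight
   [det (X^T X) ^ 2] clears the denominators and discards the dependent choices. *)
Lemma smooth_range_projector (J : set R) k (m n r : nat) (E : R -> 'M[R]_(m, n)) :
  msmooth J k E -> (forall t, J t -> \rank (E t) = r) ->
  exists P : R -> 'M[R]_m, msmooth J k P /\
    forall t, J t -> P t *m E t = E t /\ exists M, P t = E t *m M.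
Proof.
move=> sE rE.
pose X (f : {ffun 'I_r -> 'I_n}) t : 'M[R]_(m, r) := \matrix_(i, j) E t i (f j).
pose N f t := (X f t)^T *m X f t.
pose D f t := \det (N f t).
have sX f : msmooth J k (X f).
  by move=> i j; under eq_fun do rewrite mxE; exact: sE.
have sN f : msmooth J k (N f) by apply: msmoothM => //; exact: msmoothT.
have sD f : rsmooth J k (D f) by exact: rsmooth_det.
pose den t := \sum_f D f t * D f t.
have XE f t : X f t = E t *m \matrix_(i, j) (i == f j)%:R.
  apply/matrixP => i j; rewrite !mxE (bigD1 (f j)) //= !mxE eqxx mulr1.
  by rewrite big1 ?addr0// => l /negPf lf; rewrite mxE lf mulr0.
have den0 t : J t -> den t != 0.
  move=> Jt; suff [f Df] : exists f, D f t != 0.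
    apply/negP => /eqP d0;
    have pos g : true -> 0 <= D g t * D g t by move=> _; rewrite -expr2 sqr_ge0.
    have /eqP := psumr_eq0P pos d0 (i := f) isT.
    by rewrite mulf_eq0 orbb (negPf Df).
  have rT : \rank (E t)^T = r by rewrite mxrank_tr rE.
  (* Some choice must have nonzero weight: [r] independent columns of [E t], found as a maximal free
     set of rows of the transpose. *)
  pose g : 'I_r -> 'I_n := fun j => maxrankfun (E t)^T (cast_ord (esym rT) j).
  exists [ffun j => g j]; rewrite /D -unitfE -unitmxE.
  apply: gram_unit => w Xw.
  have fr : row_free (rowsub (maxrankfun (E t)^T) (E t)^T).
    exact: maxrowsub_free.
  have /row_freeP [V hV] := fr.
  pose w' : 'cV[R]_(\rank (E t)^T) := \col_i w (cast_ord rT i) 0.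
  have w'0 : w' = 0.
    have e : (rowsub (maxrankfun (E t)^T) (E t)^T)^T *m w' = 0.
      rewrite -Xw; apply/matrixP => i j; rewrite !mxE.
      rewrite (reindex (cast_ord rT)) /=; last first.
        by exists (cast_ord (esym rT)) => x _; rewrite ?cast_ordK ?cast_ordKV.
      apply: eq_bigr => l _; rewrite !mxE ffunE /g cast_ordK.
      by rewrite ord1.
    have := congr1 (mulmx V^T) e; rewrite mulmxA -trmx_mul hV trmx1 mul1mx.
    by rewrite mulmx0.
  apply/colP => i; rewrite mxE.
  have := congr1 (fun M : 'cV_(\rank (E t)^T) => M (cast_ord (esym rT) i) 0) w'0.
  by rewrite !mxE cast_ordKV.
(* One factor [D f] of the weight is spent on turning the inverse Gram matrix into the adjugate,
   which is defined for every [f]. *)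
pose S t := \sum_f D f t *: (X f t *m \adj (N f t) *m (X f t)^T).
exists (fun t => (den t)^-1 *: S t); split.
  apply: msmoothZ; first by apply: rsmoothV => //; apply: rsmooth_sum => f _; exact: rsmoothM.
  apply: msmooth_sum => f _; apply: msmoothZ => //.
  by apply: msmoothM; [apply: msmoothM => //; exact: msmooth_adj|exact: msmoothT].
move=> t Jt; split.
  have -> : (den t)^-1 *: S t *m E t = (den t)^-1 *: (den t *: E t).
    rewrite -scalemxAl; congr (_ *: _); rewrite /S mulmx_suml /den scaler_suml.
    apply: eq_bigr => f _; rewrite -scalemxAl -scalerA.
    (* If [D f] is nonzero, the chosen columns already span [im E], so the Gram projector fixes [E]
       and the term contributes [D f ^ 2] times [E]. *)
    have [->|Df] := eqVneq (D f t) 0; first by rewrite !scale0r.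
    congr (_ *: _).
    have uN : N f t \in unitmx by rewrite unitmxE unitfE.
    have rX : \rank (X f t)^T = r.
      apply/eqP; rewrite eqn_leq rank_leq_row /= -{1}(mxrank_unit uN) /N.
      exact: mxrankM_maxl.
    have /submxP [V EV] : ((E t)^T <= (X f t)^T)%MS.
      have /mxrank_leqif_eq [_] : ((X f t)^T <= (E t)^T)%MS.
        by rewrite XE trmx_mul submxMl.
      by rewrite rX mxrank_tr rE// eqxx => /esym /andP[].
    have {EV}EV : E t = X f t *m V^T by rewrite -[E t]trmxK EV trmx_mul trmxK.
    rewrite EV -!mulmxA [(X f t)^T *m _]mulmxA -/(N f t).
    rewrite [\adj _ *m _]mulmxA mul_adj_mx -/(D f t).
    by rewrite mul_scalar_mx -scalemxAr.
  by rewrite scalerA mulVf ?scale1r// den0.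
apply: lift_cols => w.
rewrite -scalemxAl /S mulmx_suml.
apply/(mem_im_mx (E t)); apply: memvZ; apply: memv_suml => f _.
apply/mem_im_mx; rewrite XE.
set B := \matrix_(i, j) _; exists (D f t *: (B *m \adj (N f t) *m (E t *m B)^T *m w)).
by rewrite -scalemxAr -scalemxAl !mulmxA.
Qed.

Lemma full_row_rows (m n p : nat) (E F : 'M[R]_(m, n)) :
  im_mx (row_mx E F) = fullv ->
  forall w : 'M[R]_(p, m), w *m E = 0 -> w *m F = 0 -> w = 0.
Proof.
move=> h w wE wF; apply/matrixP => i j.
pose e : 'cV[R]_m := delta_mx j 0.
have /mem_im_mx [u hu] : e \in im_mx (row_mx E F) by rewrite h memvf.
have : w *m e = 0 by rewrite hu mulmxA mul_mx_row wE wF row_mx0 mul0mx.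
by rewrite -colE => /(congr1 (fun M : 'cV_p => M i 0)); rewrite !mxE.
Qed.

End LinearAlgebra.

(** * From the stated notions to matrix equations *)

Section Interface.
Variable R : realType.
Implicit Types (J : set R) (t : R).

Lemma mcont_within J (p q : nat) (F : R -> 'M[R]_(p, q)) :
  msmooth J 0 F <-> {within J, continuous F}.
Proof.
rewrite subspace_continuousP; split=> [h t Jt|h i j t Jt].
  by apply/cvg_mxP => i j; exact: h.
by have /cvg_mxP := h t Jt; apply.
Qed.

Lemma Ck_on_mderiv J k (p q : nat) (F : R -> 'M[R]_(p, q)) : Ck_on J k F ->
  forall l, (l < k)%N -> forall t, J t ->
  mderiv J (deriven_on J l F) t (deriven_on J l.+1 F t).
Proof. by move=> [dF _] l lk t Jt; apply/mderivP; exact: dF. Qed.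

Lemma Ck_on_msmooth J k (p q : nat) (F : R -> 'M[R]_(p, q)) :
  Ck_on J k F -> msmooth J k F.
Proof.
move=> cF; suff : forall j l, (j + l = k)%N -> msmooth J j (deriven_on J l F).
  by move=> /(_ k 0%N); rewrite addn0; exact.
elim=> [|j IH] l jl.
  by apply/mcont_within; apply: cF.2; rewrite -jl.
apply: der_msmooth (IH l.+1 _); last by rewrite addnS.
by apply: Ck_on_mderiv cF _ _; rewrite -jl addSn ltnS leq_addl.
Qed.

Lemma msmooth_Ck_on1 J (p q : nat) (F : R -> 'M[R]_(p, q)) :
  proper_interval J -> msmooth J 1 F -> Ck_on J 1 F.
Proof.
move=> pJ sF; have [dF cF'] := msmooth_derive_on pJ sF; split.
  case=> // _ t Jt; have /mderivP h := dF t Jt; exact: (cvgP _ h).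
case=> [_|[|//] _]; apply/mcont_within => //.
exact: msmoothW sF.
Qed.

(** The content of a reduction step at a single time: subspaces become factorizations, [Z] is
    eliminated, and [rd_S] expresses that the columns of [C] span the [z] with [F z] in [im E]. The
    derivative [C'] is a parameter, so no topology is left. *)
Record reduction_data (m r : nat) (E F : 'M[R]_m) (E1 F1 : 'M[R]_r)
    (Y C C' : 'M[R]_(m, r)) : Prop := ReductionData {
  rd_Y : Y^T *m Y \in unitmx;
  rd_EY : exists M, E = Y *m M;
  rd_YE : exists M, Y = E *m M;
  rd_C : C^T *m C \in unitmx;
  rd_FC : exists W, F *m C = E *m W;
  rd_S : forall (p : nat) (X : 'M[R]_(m, p)) W, F *m X = E *m W ->
    exists V, X = C *m V;
  rd_E1 : E1 = Y^T *m E *m C;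
  rd_F1 : F1 = Y^T *m (F *m C + E *m C') }.

Lemma reductionP J (m r : nat) (E F : R -> 'M[R]_m) (E1 F1 : R -> 'M[R]_r) :
  reduction J E F E1 F1 -> exists Y C C' : R -> 'M[R]_(m, r),
    [/\ msmooth J 1 C, forall t, J t -> mderiv J C t (C' t)
      & forall t, J t ->
          reduction_data (E t) (F t) (E1 t) (F1 t) (Y t) (C t) (C' t)].
Proof.
move=> [Y [Z [C [bY bZ [bC cC] e1]]]]; exists Y, C, (derive_on J C).
split; first exact: Ck_on_msmooth.
  exact: (Ck_on_mderiv cC (ltn0Sn 0)).
move=> t Jt; have [Yim Yinj] := basis_cols (bY t Jt).
have [Zim Zinj] := basis_cols (bZ t Jt).
have [Cim Cinj] := basis_cols (bC t Jt).
have [E1E F1E] := e1 t Jt.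
have uY := gram_unit Yinj.
have EY : exists M, E t = Y t *m M.
  apply: lift_cols => w; apply/Yim; apply/mem_im_mx; by exists w.
have YE : exists M, Y t = E t *m M.
  by apply: lift_cols => w; apply/mem_im_mx; apply/Yim; exists w.
have ZE : (Z t)^T *m E t = 0.
  apply: trmx_inj; rewrite trmx_mul trmxK trmx0.
  (* For [a = E^T Z u], orthogonality of [Z u] to [E a] says that [a^T a = 0]. *)
  have NZ (u : 'cV[R]_(m - r)) : (E t)^T *m Z t *m u = 0.
    have /Zim : exists w, Z t *m u = Z t *m w by exists u.
    pose a := (E t)^T *m Z t *m u; move=> /mem_orthv /(_ (E t *m a)) h.
    rewrite -/a; apply: gram_eq0; rewrite {2}/a -mulmxA mulmxA -trmx_mul.
    by apply: h; apply/mem_im_mx; exists a.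
  apply/matrixP => i j.
  have := congr1 (fun M : 'cV[R]_m => M i 0) (NZ (delta_mx j 0)).
  by rewrite /= -colE !mxE => ->.
(* The part [g] of [f] orthogonal to [im E] lies in the span of [Z] and is also orthogonal to it,
   hence vanishes. *)
have imE (f : 'cV[R]_m) : (Z t)^T *m f = 0 -> exists w, f = E t *m w.
  move=> Zf; pose g := f - Y t *m (invmx ((Y t)^T *m Y t) *m ((Y t)^T *m f)).
  have Yg : (Y t)^T *m g = 0.
    by rewrite /g mulmxBr mulmxA (mulKVmx uY) subrr.
  have /Zim [u gu] : g \in orthv (im_mx (E t)).
    apply/mem_orthv => w /mem_im_mx [w' ->]; have [M ->] := EY.
    by rewrite !trmx_mul -!mulmxA Yg !mulmx0.
  have [N YN] := YE.
  have Zg : (Z t)^T *m g = 0.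
    by rewrite /g mulmxBr Zf {1}YN !mulmxA ZE !mul0mx subrr.
  have g0 : g = 0 by apply: gram_eq0; rewrite {1}gu trmx_mul -mulmxA Zg mulmx0.
  move/eqP: g0; rewrite subr_eq0 => /eqP ->.
  by eexists; rewrite {1}YN -mulmxA.
have SP (x : 'cV[R]_m) : (exists w, F t *m x = E t *m w) <->
    exists v, x = C t *m v.
  split=> [[w e]|/Cim /mem_ker_mx].
    by apply/Cim; apply/mem_ker_mx; rewrite -mulmxA e mulmxA ZE mul0mx.
  by rewrite -mulmxA => /imE.
split=> //.
- exact: gram_unit.
- by apply: lift_cols => w; rewrite -mulmxA; apply/SP; exists w.
- move=> p X W FX; apply: lift_cols => w; apply/SP; exists (W *m w).
  by rewrite !mulmxA FX.
Qed.

(** Rank-nullity for [E] restricted to [S = im C], since [Y^T] is injective on [im E]. *)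
Lemma rank_step (m r th : nat) (E F : 'M[R]_m) (E1 F1 : 'M[R]_r)
    (Y C C' : 'M[R]_(m, r)) :
  reduction_data E F E1 F1 Y C C' ->
  \dim (ker_mx E :&: preim_mx F (im_mx E))%VS = th -> (\rank E1 + th)%N = r.
Proof.
move=> [uY [M EM] _ uC [W FC] S -> _] <-.
have Cinj : forall w : 'cV_r, C *m w = 0 -> w = 0.
  apply: (inj_of_linv (V := invmx (C^T *m C) *m C^T)).
  by rewrite -mulmxA mulVmx.
have SE : preim_mx F (im_mx E) = im_mx C.
  apply/vspaceP => x; rewrite mem_preim_mx; apply/idP/idP.
    by move=> /mem_im_mx [w /S]; move=> h; apply/mem_im_mx.
  move=> /mem_im_mx [w ->]; apply/mem_im_mx; exists (W *m w).
  by rewrite mulmxA FC mulmxA.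
have := limg_ker_dim (linfun (mulmx E : 'cV[R]_m -> 'cV[R]_m)) (im_mx C).
rewrite SE capvC dim_im_inj // => e; rewrite -[RHS]e addnC; congr (_ + _)%N.
have -> : (linfun (mulmx E : 'cV[R]_m -> 'cV[R]_m) @: im_mx C)%VS = im_mx (E *m C).
  apply/vspaceP => x; apply/idP/idP.
    move=> /memv_imgP [u /mem_im_mx [w ->] ->]; apply/mem_im_mx; exists w.
    by rewrite lfunE /= mulmxA.
  move=> /mem_im_mx [w ->]; apply/memv_imgP; exists (C *m w).
    by apply/mem_im_mx; exists w.
  by rewrite lfunE /= mulmxA.
rewrite dim_im_mx EM -!mulmxA mulmxA (rank_injr _ (mulVmx uY)).
apply/esym; apply: (@rank_injr _ _ _ _ _ _ (invmx (Y^T *m Y) *m Y^T)).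
by rewrite -mulmxA mulVmx.
Qed.

(** The first bound makes the truncated subtraction in [d] exact; the second, from strictly
    decreasing ranks, bounds the index by the size. *)
Lemma reduction_chain_bounds J t mu (m r : nat) (E F : R -> 'M[R]_m) theta :
  J t -> reduction_chain J mu E F r theta ->
  (\sum_(j < mu.-1) theta j <= r)%N /\ (mu <= r.+1)%N.
Proof.
move=> Jt; elim: mu m r E F theta => // -[|mu] IH m r E F theta [pE].
  by rewrite big_ord0.
move=> [E1 [F1 [r1 [red r1r ch]]]].
have [h1 h2] := IH _ _ E1 F1 (fun i => theta i.+1) ch.
have [pE1 _] := ch; have [_ rE1 _] := pE1 t Jt; have [_ _ dth] := pE t Jt.
have [Y [C [C' [_ _ /(_ t Jt) rd]]]] := reductionP red.
have := rank_step rd dth; rewrite rE1 => <-.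
rewrite /= big_ord_recl addnC leq_add2r; split; first exact: h1.
have := rank_step rd dth; rewrite rE1 => e.
by rewrite e; exact: leq_trans h2 r1r.
Qed.

End Interface.

(** * One reduction step for smooth pairs *)

Section Reduction.
Variable R : realType.
Implicit Types (J : set R) (t : R).

Definition dsol J (m : nat) (E F : R -> 'M[R]_m) (q x : R -> 'cV[R]_m) : Prop :=
  exists x', [/\ forall t, J t -> mderiv J x t (x' t), msmooth J 0 x'
    & forall t, J t -> E t *m x' t + F t *m x t = q t].

(** [Y Vy] projects onto [im E], with complement [U W]; [C Vc] projects onto [ker (W F)], with
    complement [B F]. Multiplying the DAE by [W] leaves the constraint [W F x = W q], which [B]
    solves: it is equivalent to [x = C z + B q] for some [z]. *)
Record splitting J k (m r : nat) (E F : R -> 'M[R]_m) (Y : R -> 'M[R]_(m, r))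
    (Vy : R -> 'M[R]_(r, m)) (U : R -> 'M[R]_(m, m - r))
    (W : R -> 'M[R]_(m - r, m)) (C : R -> 'M[R]_(m, r))
    (Vc : R -> 'M[R]_(r, m)) (B : R -> 'M[R]_m) : Prop := Splitting {
  sp_Vy : msmooth J k Vy;
  sp_C : msmooth J k C;
  sp_Vc : msmooth J k Vc;
  sp_B : msmooth J k B;
  sp_VyY : forall t, J t -> Vy t *m Y t = 1%:M;
  sp_YU : forall t, J t -> Y t *m Vy t + U t *m W t = 1%:M;
  sp_YE : forall t, J t -> exists M, Y t = E t *m M;
  sp_WE : forall t, J t -> W t *m E t = 0;
  sp_VcC : forall t, J t -> Vc t *m C t = 1%:M;
  sp_CB : forall t, J t -> C t *m Vc t + B t *m F t = 1%:M;
  sp_WFC : forall t, J t -> W t *m F t *m C t = 0;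
  sp_WFB : forall t, J t -> W t *m F t *m B t = W t;
  sp_BU : forall t, J t -> B t *m U t *m W t = B t }.

Lemma smooth_splitting J k (m r : nat) (E F : R -> 'M[R]_m) :
  proper_interval J -> msmooth J k.+1 E -> msmooth J k.+1 F ->
  (forall t, J t -> \rank (E t) = r) ->
  (forall t, J t -> forall w : 'rV_m, w *m E t = 0 -> w *m F t = 0 -> w = 0) ->
  exists (Y : R -> 'M[R]_(m, r)) (Vy : R -> 'M[R]_(r, m))
    (U : R -> 'M[R]_(m, m - r)) (W : R -> 'M[R]_(m - r, m))
    (C : R -> 'M[R]_(m, r)) (Vc : R -> 'M[R]_(r, m)) (B : R -> 'M[R]_m),
    splitting J k.+1 E F Y Vy U W C Vc B.
Proof.
move=> pJ sE sF rE full; have [iJ [a /interior_subset Ja]] := pJ.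
have [P [sP hP]] := smooth_range_projector sE rE.
have PP t : J t -> P t *m P t = P t.
  by move=> /hP [PE [M PM]]; rewrite {2}PM mulmxA PE -PM.
have rP : \rank (P a) = r.
  rewrite -(rE a Ja); have [PE [M PM]] := hP a Ja.
  apply/eqP; rewrite eqn_leq {1}PM mxrankM_maxl /=.
  by rewrite -{1}PE mxrankM_maxl.
have rm : (r <= m)%N by rewrite -rP rank_leq_row.
have [Y [Vy [sY sVy hY]]] := smooth_projector_factor iJ Ja sP PP rP pJ.
have sQ : msmooth J k.+1 (fun t => 1%:M - P t) by apply: msmoothB => //; exact: msmooth_cst.
have QQ t : J t -> (1%:M - P t) *m (1%:M - P t) = 1%:M - P t.
  by move=> Jt; rewrite mulmxBl mul1mx mulmxBr mulmx1 PP// subrr subr0.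
have rQ : \rank (1%:M - P a) = (m - r)%N by rewrite rank_compl_proj ?PP// rP.
have [U [W [sU sW hU]]] := smooth_projector_factor iJ Ja sQ QQ rQ pJ.
have WE t : J t -> W t *m E t = 0.
  move=> Jt; have [QU WU] := hU t Jt; have [PE _] := hP t Jt.
  have : U t *m (W t *m E t) = 0 by rewrite mulmxA -QU mulmxBl mul1mx PE subrr.
  by move/(congr1 (mulmx (W t))); rewrite mulmxA WU mul1mx mulmx0.
pose G t := W t *m F t.
have sG : msmooth J k.+1 G by exact: msmoothM.
(* Surjectivity of [[E F]] enters here: if [w G = 0], then [w W] kills both [E] and [F], so
   [G = W F] has full row rank. *)
have uG t : J t -> G t *m (G t)^T \in unitmx.
  move=> Jt; rewrite -{1}[G t]trmxK; apply: gram_unit => w Gw.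
  have [_ WU] := hU t Jt.
  apply: trmx_inj; rewrite trmx0 -[w^T]mulmx1 -WU mulmxA.
  suff -> : w^T *m W t = 0 by rewrite mul0mx.
  apply: (full t Jt); first by rewrite -mulmxA WE// mulmx0.
  by apply: trmx_inj; rewrite -mulmxA trmx_mul trmxK Gw trmx0.
(* The Moore-Penrose right inverse of [G], smooth in time; [1 - GR G] then projects onto [ker G], of
   rank [m - (m - r) = r]. *)
pose GR t := (G t)^T *m invmx (G t *m (G t)^T).
have sGR : msmooth J k.+1 GR.
  apply: msmoothM; first exact: msmoothT.
  by apply: msmooth_inv => //; apply: msmoothM => //; exact: msmoothT.
have GGR t : J t -> G t *m GR t = 1%:M.
  by move=> Jt; rewrite mulmxA mulmxV// uG.
clearbody GR.
pose T t := 1%:M - GR t *m G t.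
have sT : msmooth J k.+1 T by apply: msmoothB; [exact: msmooth_cst|exact: msmoothM].
have TT t : J t -> T t *m T t = T t.
  move=> Jt; rewrite /T mulmxBl mul1mx mulmxBr mulmx1 [X in _ - X](_ : _ = 0) ?subr0//.
  by rewrite -mulmxA [G t *m _]mulmxA GGR// mul1mx subrr.
have rT : \rank (T a) = r.
  rewrite rank_compl_proj; last by rewrite -mulmxA [G a *m _]mulmxA GGR// mul1mx.
  rewrite (rank_injr _ (GGR a Ja)).
  have /eqP -> : row_free (G a) by apply/row_freeP; exists (GR a); exact: GGR.
  by rewrite subKn.
have [C [Vc [sC sVc hC]]] := smooth_projector_factor iJ Ja sT TT rT pJ.
exists Y, Vy, U, W, C, Vc, (fun t => GR t *m W t); split=> //.
- exact: msmoothM.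
- by move=> t /hY [].
- by move=> t Jt; rewrite -(hY t Jt).1 -(hU t Jt).1 addrC subrK.
- move=> t Jt; have [_ [M PM]] := hP t Jt; exists (M *m Y t).
  by rewrite mulmxA -PM (hY t Jt).1 -mulmxA (hY t Jt).2 mulmx1.
- by move=> t /hC [].
- by move=> t Jt; rewrite -(hC t Jt).1 /T -mulmxA subrK.
- move=> t Jt; have [TC VcC] := hC t Jt.
  have GT : G t *m T t = 0 by rewrite /T mulmxBr mulmx1 mulmxA GGR// mul1mx subrr.
  by rewrite -/(G t) -[C t]mulmx1 -VcC [C t *m _]mulmxA -TC mulmxA GT mul0mx.
- by move=> t Jt; rewrite -/(G t) mulmxA GGR// mul1mx.
- by move=> t Jt; rewrite -2!mulmxA [W t *m _]mulmxA (hU t Jt).2 mul1mx.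
Qed.

Section OneStep.
Variables (J : set R) (k m r : nat) (E F : R -> 'M[R]_m) (Y : R -> 'M[R]_(m, r))
  (Vy : R -> 'M[R]_(r, m)) (U : R -> 'M[R]_(m, m - r))
  (W : R -> 'M[R]_(m - r, m)) (C : R -> 'M[R]_(m, r))
  (Vc : R -> 'M[R]_(r, m)) (B : R -> 'M[R]_m).
Hypothesis pJ : proper_interval J.
Hypothesis sp : splitting J k.+1 E F Y Vy U W C Vc B.

(** These four coefficients come from substituting [x = C z + B q] into the DAE and multiplying by
    [Vy]: [next_E z' + next_F z = next_q0 q + next_q1 q']. *)
Definition next_E t := Vy t *m E t *m C t.
Definition next_F t := Vy t *m (F t *m C t + E t *m derive_on J C t).
Definition next_q0 t := Vy t *m (1%:M - F t *m B t - E t *m derive_on J B t).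
Definition next_q1 t := - (Vy t *m E t *m B t).

Lemma next_smooth : msmooth J k.+1 E -> msmooth J k.+1 F ->
  [/\ msmooth J k.+1 next_E, msmooth J k next_F, msmooth J k next_q0 & msmooth J k.+1 next_q1].
Proof.
move=> sE sF; have [_ sC'] := msmooth_derive_on pJ (sp_C sp).
have [_ sB'] := msmooth_derive_on pJ (sp_B sp).
have W1 p q (M : R -> 'M[R]_(p, q)) : msmooth J k.+1 M -> msmooth J k M.
  exact: msmoothW (leqnSn k).
have [sVy sC sB] := And3 (sp_Vy sp) (sp_C sp) (sp_B sp).
split.
- by apply: msmoothM => //; exact: msmoothM.
- apply: msmoothM; first exact: W1.
  by apply: msmoothD; [apply/W1/msmoothM|apply: msmoothM => //; exact: W1].
- apply: msmoothM; first exact: W1.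
  apply: msmoothB; last by apply: msmoothM => //; exact: W1.
  by apply: msmoothB; [exact: msmooth_cst|apply/W1/msmoothM].
- by apply: msmoothN; apply: msmoothM => //; exact: msmoothM.
Qed.

(** As [Y Vy + U W = 1], the DAE splits into its [W] part, which is the formula for [x], and its
    [Vy] part, which is the next DAE. The coordinate is [z = Vc (x - B q)]. *)
Lemma next_solution J' q q' x : proper_interval J' -> J' `<=` J ->
  (forall t, J' t -> mderiv J' q t (q' t)) -> msmooth J' 0 q' ->
  dsol J' E F q x <->
  exists z, dsol J' next_E next_F (fun t => next_q0 t *m q t + next_q1 t *m q' t) z
    /\ forall t, J' t -> x t = C t *m z t + B t *m q t.
Proof.
move=> pJ' sJ dq cq'.
have der1 p1 p2 (M : R -> 'M[R]_(p1, p2)) : msmooth J k.+1 M ->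
    (forall t, J' t -> mderiv J' M t (derive_on J M t)) /\ msmooth J' 0 (derive_on J M).
  move=> sM; have [dM cM] := msmooth_derive_on pJ sM; split.
    by move=> t Jt; apply: (sub_mderiv sJ); apply: dM; exact: sJ.
  by apply: (sub_msmooth sJ); exact: msmoothW cM.
have [dC cC'] := der1 _ _ _ (sp_C sp).
have [dB cB'] := der1 _ _ _ (sp_B sp).
have [dV cV'] := der1 _ _ _ (sp_Vc sp).
have cont p1 p2 (M : R -> 'M[R]_(p1, p2)) : msmooth J k.+1 M -> msmooth J' 0 M.
  by move=> sM; apply: (sub_msmooth sJ); exact: msmoothW sM.
have cC := cont _ _ _ (sp_C sp); have cB := cont _ _ _ (sp_B sp).
have cV := cont _ _ _ (sp_Vc sp).
have der0 p1 p2 (M M' : R -> 'M[R]_(p1, p2)) :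
    (forall t, J' t -> mderiv J' M t (M' t)) -> msmooth J' 0 M.
  by move=> dM i j t Jt; exact: rderiv_cvg (dM t Jt i j).
have cq := der0 _ _ _ _ dq.
split.
- move=> [x' [dx cx' ex]]; have cx := der0 _ _ _ _ dx.
  pose z t := Vc t *m (x t - B t *m q t).
  pose z' t := derive_on J Vc t *m (x t - B t *m q t) +
    Vc t *m (x' t - (derive_on J B t *m q t + B t *m q' t)).
  have dz t : J' t -> mderiv J' z t (z' t).
    move=> Jt; apply: mderivM; first exact: dV.
    by apply: mderivB; [exact: dx|apply: mderivM; [exact: dB|exact: dq]].
  have Cz t : J' t -> C t *m z t = x t - B t *m q t.
    move=> Jt; have Jt' := sJ t Jt.
    rewrite /z mulmxA; have /eqP := sp_CB sp Jt'; rewrite eq_sym -subr_eq => /eqP <-.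
    have Wq : W t *m q t = W t *m (F t *m x t).
      by rewrite -(ex t Jt) mulmxDr mulmxA (sp_WE sp Jt') mul0mx add0r.
    have e : B t *m F t *m x t = B t *m q t.
      by rewrite -(sp_BU sp Jt') -!mulmxA Wq.
    have WFBq : W t *m (F t *m (B t *m q t)) = W t *m q t.
      by rewrite !mulmxA (sp_WFB sp Jt').
    have e2 : B t *m F t *m (B t *m q t) = B t *m q t.
      by rewrite -{1}(sp_BU sp Jt') -!mulmxA WFBq !mulmxA (sp_BU sp Jt').
    rewrite mulmxBl mul1mx mulmxBr e e2 subrr subr0//.
  exists z; split; last by move=> t Jt; rewrite Cz// subrK.
  exists z'; split=> //.
    apply: msmoothD; apply: msmoothM => //; apply: msmoothB => //; first exact: msmoothM.
    by apply: msmoothD; exact: msmoothM.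
  move=> t Jt.
  (* Both sides are derivatives of the same function, [C z = x - B q]. *)
  have Cz' : derive_on J C t *m z t + C t *m z' t =
      x' t - (derive_on J B t *m q t + B t *m q' t).
    apply: (mderiv_unique pJ' Jt (mderivM (dC t Jt) (dz t Jt))).
    apply: (@eq_mderiv _ _ _ _ (fun t => x t - B t *m q t)) => //.
      by move=> s Js; rewrite Cz.
    by apply: mderivB; [exact: dx|apply: mderivM; [exact: dB|exact: dq]].
  have -> : next_E t *m z' t + next_F t *m z t =
      Vy t *m (E t *m (derive_on J C t *m z t + C t *m z' t) +
        F t *m (C t *m z t)).
    rewrite /next_E /next_F !(mulmxDl, mulmxDr) !mulmxA.
    by rewrite addrA addrC addrA.
  rewrite Cz' Cz// mulmxBr mulmxBr.
  have -> : E t *m x' t - E t *m (derive_on J B t *m q t + B t *m q' t) +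
      (F t *m x t - F t *m (B t *m q t)) =
      q t - F t *m (B t *m q t) - E t *m (derive_on J B t *m q t + B t *m q' t).
    by rewrite -(ex t Jt) addrACA -opprD [X in _ - X]addrC opprD addrA.
  rewrite /next_q0 /next_q1 !(mulmxDl, mulmxDr, mulNmx, mulmxN, mulmxBl, mulmxBr).
  by rewrite mulmx1 !mulmxA opprD !addrA.
- move=> [z [[z' [dz cz' ez]] ex]]; have cz := der0 _ _ _ _ dz.
  exists (fun t => (derive_on J C t *m z t + C t *m z' t) +
    (derive_on J B t *m q t + B t *m q' t)); split.
  + move=> t Jt; apply: (@eq_mderiv _ _ _ _ (fun t => C t *m z t + B t *m q t)) => //.
      by move=> s Js; rewrite ex.
    by apply: mderivD; apply: mderivM; [exact: dC|exact: dz|exact: dB|exact: dq].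
  + by apply: msmoothD; apply: msmoothD; exact: msmoothM.
  + move=> t Jt; have Jt' := sJ t Jt.
    apply/eqP; rewrite -subr_eq0; apply/eqP.
    set rho := (X in X = 0).
    have Vrho : Vy t *m rho = 0.
      have := ez t Jt; move/eqP; rewrite -subr_eq0 => /eqP <-.
      rewrite /rho ex// /next_E /next_F /next_q0 /next_q1.
      rewrite !(mulmxDl, mulmxDr, mulNmx, mulmxN) !mulmx1 !mulmxA.
      move: (Vy t *m q t) => v1; move: (Vy t *m E t *m C t *m z' t) => v2.
      move: (Vy t *m F t *m C t *m z t) => v3.
      move: (Vy t *m E t *m derive_on J C t *m z t) => v4.
      move: (Vy t *m F t *m B t *m q t) => v5.
      move: (Vy t *m E t *m derive_on J B t *m q t) => v6.
      move: (Vy t *m E t *m B t *m q' t) => v7.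
      by apply/matrixP => i j; rewrite !mxE; ring.
    have Wrho : W t *m rho = 0.
      rewrite /rho mulmxBr mulmxDr mulmxA (sp_WE sp Jt') mul0mx add0r ex//.
      rewrite !mulmxDr !mulmxA (sp_WFC sp Jt') mul0mx add0r.
      by rewrite (sp_WFB sp Jt') subrr.
    by rewrite -[rho]mul1mx -(sp_YU sp Jt') mulmxDl -!mulmxA Vrho Wrho !mulmx0 addr0.
Qed.

End OneStep.
End Reduction.

(** * Solutions as differential operators of the right-hand side *)

Section DifferentialOperators.
Variable R : realType.
Implicit Types (J : set R) (t : R).

(** Any compatible sequence of derivatives, not necessarily [deriven_on], so that restriction to a
    subinterval or application of a differential operator requires no new limits. *)
Definition jet J k (m : nat) (qs : nat -> R -> 'cV[R]_m) : Prop :=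
  (forall l, (l < k)%N -> forall t, J t -> mderiv J (qs l) t (qs l.+1 t)) /\
  (forall l, (l <= k)%N -> msmooth J 0 (qs l)).

(* Coefficients of the [l]-th derivative of [\sum_j N j *m q^(j)]. *)
Fixpoint leibniz J (p m : nat) (N : nat -> R -> 'M[R]_(p, m)) (l : nat) :
    nat -> R -> 'M[R]_(p, m) :=
  if l is l'.+1 then fun j t => derive_on J (leibniz J N l' j) t +
    (if j is j'.+1 then leibniz J N l' j' t else 0)
  else N.

Variables (J : set R) (p m n k : nat) (N : nat -> R -> 'M[R]_(p, m)).
Hypothesis pJ : proper_interval J.
Hypothesis sN : forall j, msmooth J k (N j).
Hypothesis N0 : forall j t, (n <= j)%N -> J t -> N j t = 0.

Lemma leibniz_smooth l j : (l <= k)%N -> msmooth J (k - l) (leibniz J N l j).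
Proof.
elim: l j => [|l IH] j lk; first by rewrite subn0; exact: sN.
have lk' := ltnW lk.
have e : (k - l = (k - l.+1).+1)%N by rewrite subnSK.
have S i : msmooth J (k - l.+1).+1 (leibniz J N l i) by rewrite -e; exact: IH.
apply: msmoothD; first exact: (msmooth_derive_on pJ (S j)).2.
by case: j => [|j]; [exact: msmooth_cst|exact: msmoothW (leqnSn _) (S j)].
Qed.

Lemma leibniz_der l j t : (l < k)%N -> J t ->
  mderiv J (leibniz J N l j) t (derive_on J (leibniz J N l j) t).
Proof.
move=> lk Jt; have := leibniz_smooth j (ltnW lk).
have -> : (k - l = (k - l.+1).+1)%N by rewrite subnSK.
by move=> S; exact: (msmooth_derive_on pJ S).1.
Qed.

Lemma leibniz_zero l j t : (l <= k)%N -> (n + l <= j)%N -> J t ->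
  leibniz J N l j t = 0.
Proof.
elim: l j t => [|l IH] j t lk nj Jt; first by rewrite /= N0// -(addn0 n).
have nj' : (n + l < j)%N by rewrite -addnS.
have dz : derive_on J (leibniz J N l j) t = 0.
  apply: (mderiv_unique pJ Jt (leibniz_der lk Jt)).
  apply: (@eq_mderiv _ _ _ _ (fun=> 0)) => //; last exact: mderiv_cst.
  by move=> s Js; rewrite IH// ltnW.
rewrite /= dz add0r.
by case: j nj' {nj dz} => // j nj; rewrite IH// ltnW.
Qed.

Definition opjet (qs : nat -> R -> 'cV[R]_m) l t : 'cV[R]_p :=
  \sum_(j < n + l) leibniz J N l j t *m qs j t.

Lemma opjet_widen K l qs t : (l <= k)%N -> (n + l <= K)%N -> J t ->
  opjet qs l t = \sum_(j < K) leibniz J N l j t *m qs j t.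
Proof.
move=> lk nlK Jt; rewrite /opjet.
rewrite (big_ord_widen K (fun j => leibniz J N l j t *m qs j t) nlK).
rewrite big_mkcond /=; apply: eq_bigr => j _; case: ltnP => // h.
by rewrite leibniz_zero// mul0mx.
Qed.

(** An operator with [n] coefficients uses derivatives up to order [n - 1], hence the count
    [n + k1 <= k'.+1]. *)
Lemma opjet_jet J' k' k1 qs : proper_interval J' -> J' `<=` J ->
  (k1 <= k)%N -> (n + k1 <= k'.+1)%N -> jet J' k' qs -> jet J' k1 (opjet qs).
Proof.
move=> pJ' sJ k1k nk [dq cq]; split=> l lk1.
  move=> t Jt; have Jt' := sJ t Jt; have lk := leq_trans lk1 k1k.
  have jk j : (j < n + l)%N -> (j < k')%N.
    move=> h; rewrite -ltnS; apply: leq_trans nk.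
    by apply: leq_ltn_trans h _; rewrite ltn_add2l.
  have := @mderiv_sum R J' p 1 _ (index_enum 'I_(n + l)) predT
    (fun j s => leibniz J N l j s *m qs j s) t
    (fun j => derive_on J (leibniz J N l j) t *m qs j t +
      leibniz J N l j t *m qs j.+1 t).
  rewrite [X in mderiv _ _ _ X](_ : _ = opjet qs l.+1 t).
    apply=> j _; apply: mderivM; last by apply: dq => //; exact: jk.
    by apply: (sub_mderiv sJ); exact: leibniz_der.
  (* The sum for [l.+1] has one more term: there the derivative part is zero, and the shifted part
     becomes the last term of the reindexed sum [g], whose term 0 vanishes. *)
  rewrite /opjet addnS /= [RHS]big_ord_recr /= big_split /=.
  under [X in _ = X + _]eq_bigr do rewrite mulmxDl.
  rewrite /= big_split /= mulmxDl.
  have -> : derive_on J (leibniz J N l (n + l)%N) t = 0.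
    apply: (mderiv_unique pJ Jt' (leibniz_der lk Jt')).
    apply: (@eq_mderiv _ _ _ _ (fun=> 0)) => //; last exact: mderiv_cst.
    by move=> s Js; rewrite leibniz_zero// ltnW.
  rewrite mul0mx add0r -addrA; congr (_ + _).
  pose g j := (if j is j'.+1 then leibniz J N l j' t else 0) *m qs j t.
  have -> : \sum_(i < n + l) leibniz J N l i t *m qs i.+1 t =
      \sum_(i < (n + l).+1) g i.
    by rewrite big_ord_recl /g mul0mx add0r.
  by rewrite big_ord_recr.
apply: msmooth_sum => j _; apply: msmoothM; last first.
  apply: cq; rewrite -ltnS; apply: leq_trans nk.
  by apply: leq_trans (ltn_ord j) _; rewrite leq_add2l.
apply: (sub_msmooth sJ); apply: msmoothW (leibniz_smooth _ (leq_trans lk1 k1k)).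
exact: leq0n.
Qed.

End DifferentialOperators.

(** * Solution formulas and their propagation through a reduction step *)

Section Solvable.
Variable R : realType.
Implicit Types (J : set R) (t : R).

(** [v] solves the inherent differential equation, of dimension [d], and [V] witnesses injectivity
    of [D]. Arbitrary [J'] allow local solutions; arbitrary jets allow the transformed right-hand
    sides of a reduction. *)
Definition solvable_form J k (m : nat) (E F : R -> 'M[R]_m) (mu d : nat) : Prop :=
  exists (D : R -> 'M[R]_(m, d)) (V : R -> 'M[R]_(d, m)) (A : R -> 'M[R]_d)
    (H : nat -> R -> 'M[R]_m) (B : nat -> R -> 'M[R]_(d, m)),
  [/\ [/\ msmooth J 1 D, msmooth J 0 V & msmooth J 0 A],
      forall l, (l < mu)%N -> msmooth J 1 (H l) /\ msmooth J 0 (B l),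
      forall t, J t -> V t *m D t = 1%:M
    & forall J' qs x, proper_interval J' -> J' `<=` J -> jet J' k qs ->
      dsol J' E F (qs 0%N) x <-> exists v,
        (forall t, J' t -> mderiv J' v t (A t *m v t + \sum_(l < mu) B l t *m qs l t))
        /\ forall t, J' t -> x t = D t *m v t + \sum_(l < mu) H l t *m qs l t].

Section Steps.
Variables (J : set R) (k m r : nat) (E F : R -> 'M[R]_m) (Y : R -> 'M[R]_(m, r))
  (Vy : R -> 'M[R]_(r, m)) (U : R -> 'M[R]_(m, m - r))
  (W : R -> 'M[R]_(m - r, m)) (C : R -> 'M[R]_(m, r))
  (Vc : R -> 'M[R]_(r, m)) (B : R -> 'M[R]_m).
Hypothesis pJ : proper_interval J.
Hypothesis sp : splitting J k.+1 E F Y Vy U W C Vc B.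
Hypotheses (sE : msmooth J k.+1 E) (sF : msmooth J k.+1 F).

Let E1 := next_E E Vy C.
Let F1 := next_F J E F Vy C.
Let N0 := next_q0 J E F Vy B.
Let N1 := next_q1 E Vy B.

(* The substitution [v = z - T q], [T = E1^-1 N1], removes [q'] from the
   differential equation for [z]. *)
Lemma solvable_form_base : (forall t, J t -> E1 t \in unitmx) ->
  solvable_form J k.+1 E F 1 r.
Proof.
move=> uE1; have [sE1 sF1 sN0 sN1] := next_smooth pJ sp sE sF.
rewrite -/E1 -/F1 -/N0 -/N1 in sE1 sF1 sN0 sN1.
have sol J' qs x : proper_interval J' -> J' `<=` J -> jet J' k.+1 qs ->
    dsol J' E F (qs 0%N) x <-> exists z,
      dsol J' E1 F1 (fun t => N0 t *m qs 0%N t + N1 t *m qs 1%N t) z /\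
      forall t, J' t -> x t = C t *m z t + B t *m qs 0%N t.
  move=> pJ' sJ [dq cq].
  exact: (next_solution pJ sp x pJ' sJ (dq 0%N isT) (cq 1%N isT)).
clearbody E1 F1 N0 N1.
have siE1 : msmooth J k.+1 (fun t => invmx (E1 t)) by exact: msmooth_inv.
pose T t := invmx (E1 t) *m N1 t.
have sT : msmooth J k.+1 T by exact: msmoothM.
have [dT sT'] := msmooth_derive_on pJ sT.
pose A t := - (invmx (E1 t) *m F1 t).
have TE0 t : T t = invmx (E1 t) *m N1 t by [].
have AE t : A t = - (invmx (E1 t) *m F1 t) by [].
have W0 p q (M : R -> 'M[R]_(p, q)) l : msmooth J l M -> msmooth J 0 M.
  exact: msmoothW (leq0n l).
have W1 p q (M : R -> 'M[R]_(p, q)) : msmooth J k.+1 M -> msmooth J 1 M.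
  exact: msmoothW.
have cA : msmooth J 0 A by apply: msmoothN; apply: msmoothM; [exact: W0 siE1|exact: W0 sF1].
clearbody A T.
exists C, Vc, A, (fun _ t => C t *m T t + B t),
  (fun _ t => A t *m T t + invmx (E1 t) *m N0 t - derive_on J T t).
split.
- by split; [exact: W1 (sp_C sp)|exact: W0 (sp_Vc sp)|].
- move=> l _; split.
    apply: msmoothD; last exact: W1 (sp_B sp).
    by apply: msmoothM; apply: W1; [exact: sp_C sp|].
  apply: msmoothB; last exact: W0 sT'.
  apply: msmoothD; apply: msmoothM => //; [exact: W0 sT|exact: W0 siE1|exact: W0 sN0].
- exact: sp_VcC sp.
- move=> J' qs x pJ' sJ jq; rewrite (sol _ _ x pJ' sJ jq); case: jq => dq cq.
  have dq0 := dq 0%N isT; have cq1 := cq 1%N isT.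
  have dT' t : J' t -> mderiv J' T t (derive_on J T t).
    by move=> Jt; apply: (sub_mderiv sJ); apply: dT; exact: sJ.
  have TE t : J' t -> E1 t *m T t = N1 t by move=> /sJ /uE1 u; rewrite TE0 mulKVmx.
  split=> [[z [[z' [dz cz' ez]] ex]]|[v [dv ex]]].
    exists (fun t => z t - T t *m qs 0%N t); split; last first.
      move=> t Jt; rewrite ex// big_ord1 mulmxDl mulmxBr mulmxA addrA.
      by rewrite addrNK.
    move=> t Jt; rewrite big_ord1.
    have := mderivB (dz t Jt) (mderivM (dT' t Jt) (dq0 t Jt)).
    rewrite [X in mderiv _ _ _ X -> _](_ : _ = A t *m (z t - T t *m qs 0%N t) +
      (A t *m T t + invmx (E1 t) *m N0 t - derive_on J T t) *m qs 0%N t)//.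
    have u := uE1 t (sJ t Jt).
    have -> : z' t = invmx (E1 t) *m N0 t *m qs 0%N t + T t *m qs 1%N t +
        A t *m z t.
      have Ez : E1 t *m z' t = N0 t *m qs 0%N t + N1 t *m qs 1%N t - F1 t *m z t.
        by rewrite -(ez t Jt) addrK.
      by rewrite -[z' t](mulKmx u) Ez mulmxBr mulmxDr AE TE0 !mulNmx !mulmxA.
    rewrite mulmxBr !mulmxDl [- derive_on J T t *m _]mulNmx mulmxA.
    move: (invmx (E1 t) *m N0 t *m qs 0%N t) => v1; move: (T t *m qs 1%N t) => v2.
    move: (A t *m z t) => v3; move: (derive_on J T t *m qs 0%N t) => v4.
    move: (A t *m T t *m qs 0%N t) => v5.
    by apply/matrixP => i j; rewrite !mxE; ring.
  exists (fun t => v t + T t *m qs 0%N t); split; last first.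
    by move=> t Jt; rewrite ex// big_ord1 mulmxDl mulmxDr mulmxA addrA.
  pose v' t := A t *m v t + (A t *m T t + invmx (E1 t) *m N0 t - derive_on J T t)
    *m qs 0%N t.
  have dv' t : J' t -> mderiv J' v t (v' t).
    by move=> Jt; have := dv t Jt; rewrite big_ord1.
  have cv : msmooth J' 0 v by move=> i j t Jt; exact: rderiv_cvg (dv' t Jt i j).
  have rJ p q (M : R -> 'M[R]_(p, q)) l : msmooth J l M -> msmooth J' 0 M.
    by move=> sM; apply: (sub_msmooth sJ); exact: W0 sM.
  have cq0 := cq 0%N isT.
  exists (fun t => v' t + (derive_on J T t *m qs 0%N t + T t *m qs 1%N t)); split.
  + by move=> t Jt; apply: mderivD; [exact: dv'|apply: mderivM; [exact: dT'|exact: dq0]].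
  + apply: msmoothD; last by apply: msmoothD; apply: msmoothM => //; [exact: rJ sT'|exact: rJ sT].
    apply: msmoothD; apply: msmoothM => //; first exact: rJ cA.
    apply: (rJ _ _ _ 0); apply: msmoothB; last exact: W0 sT'.
    apply: msmoothD; apply: msmoothM => //; [exact: W0 sT|exact: W0 siE1|exact: W0 sN0].
  + move=> t Jt; have u := uE1 t (sJ t Jt).
    have EA : E1 t *m A t = - F1 t by rewrite AE mulmxN mulKVmx.
    rewrite /v' !(mulmxDr, mulmxDl, mulmxN, mulNmx) !mulmxA EA (mulmxV u) TE//.
    rewrite !mul1mx !mulNmx.
    move: (N0 t *m qs 0%N t) => v1; move: (N1 t *m qs 1%N t) => v2.
    move: (E1 t *m derive_on J T t *m qs 0%N t) => v3.
    move: (F1 t *m v t) => v4; move: (F1 t *m T t *m qs 0%N t) => v5.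
    by apply/matrixP => i j; rewrite !mxE; ring.
Qed.

(** The next right-hand side is [N0 q + N1 q']; its derivatives of order below [mu] involve [q] up
    to order [mu], whence index [mu.+1]. As [l < mu < k], the Leibniz coefficients remain C^1. *)
Lemma solvable_form_step mu d : (mu < k)%N ->
  solvable_form J k E1 F1 mu d -> solvable_form J k.+1 E F mu.+1 d.
Proof.
move=> muk [D [V [A [H [G [[sD sV sA] sHG VD sol1]]]]]].
have [_ _ sN0 sN1] := next_smooth pJ sp sE sF.
pose N j := if j is j'.+1 then (if j' is 0%N then N1 else fun=> 0) else N0.
have sN j : msmooth J k (N j).
  by case: j => [|[|j]] //=; [exact: msmoothW (leqnSn k) sN1|exact: msmooth_cst].
have Nz j t : (2 <= j)%N -> J t -> N j t = 0 by case: j => [|[|j]].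
pose L := leibniz J N.
have sL l j : (l <= k)%N -> msmooth J (k - l) (L l j).
  by move=> lk; exact: leibniz_smooth.
have sol J' qs x : proper_interval J' -> J' `<=` J -> jet J' k.+1 qs ->
    dsol J' E F (qs 0%N) x <-> exists z,
      dsol J' E1 F1 (opjet J 2 N qs 0%N) z /\
      forall t, J' t -> x t = C t *m z t + B t *m qs 0%N t.
  move=> pJ' sJ [dq cq].
  have -> : opjet J 2 N qs 0%N = (fun t => N0 t *m qs 0%N t + N1 t *m qs 1%N t).
    by apply/funext => t; rewrite /opjet addn0 !big_ord_recl big_ord0 /= addr0.
  exact: (next_solution pJ sp x pJ' sJ (dq 0%N isT) (cq 1%N isT)).
have wid l qs t : (l < mu)%N -> J t ->
    opjet J 2 N qs l t = \sum_(j < mu.+1) L l j t *m qs j t.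
  move=> lm Jt; apply: (opjet_widen pJ sN Nz) => //.
  exact: ltnW (ltn_trans lm muk).
have jt J' qs : proper_interval J' -> J' `<=` J -> jet J' k.+1 qs ->
    jet J' k (opjet J 2 N qs).
  move=> pJ' sJ.
  exact: (@opjet_jet _ _ _ _ 2 _ _ pJ sN Nz _ _ _ _ pJ' sJ (leqnn k) (leqnn k.+2)).
(* Exchanging the sums gathers the coefficient of each derivative of [q]. *)
have collect p (M : nat -> R -> 'M[R]_(p, r)) (qs : nat -> R -> 'cV[R]_m) t : J t ->
    \sum_(j < mu.+1) (\sum_(l < mu) M l t *m L l j t) *m qs j t =
    \sum_(l < mu) M l t *m opjet J 2 N qs l t.
  move=> Jt; under eq_bigr do rewrite mulmx_suml.
  rewrite exchange_big /=; apply: eq_bigr => l _; rewrite wid// mulmx_sumr.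
  by apply: eq_bigr => j _; rewrite mulmxA.
clearbody E1 F1 N0 N1 L.
have sC : msmooth J 1 C by exact: msmoothW (sp_C sp).
exists (fun t => C t *m D t), (fun t => V t *m Vc t), A,
  (fun j t => (if j is 0%N then B t else 0) +
    \sum_(l < mu) C t *m H l t *m L l j t),
  (fun j t => \sum_(l < mu) G l t *m L l j t).
split.
- split=> //; first exact: msmoothM.
  by apply: msmoothM => //; exact: msmoothW (sp_Vc sp).
- move=> j _; split.
    apply: msmoothD; first by case: j => [|j]; [exact: msmoothW (sp_B sp)|exact: msmooth_cst].
    apply: msmooth_sum => l _; apply: msmoothM.
      by apply: msmoothM => //; exact: (sHG l (ltn_ord l)).1.
    have lk := ltn_trans (ltn_ord l) muk.
    by apply: msmoothW (sL l j (ltnW lk)); rewrite subn_gt0.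
  apply: msmooth_sum => l _; apply: msmoothM; first exact: (sHG l (ltn_ord l)).2.
  apply: msmoothW (sL l j (ltnW (ltn_trans (ltn_ord l) muk))); exact: leq0n.
- move=> t Jt; rewrite mulmxA -[V t *m _ *m _]mulmxA (sp_VcC sp Jt) mulmx1.
  exact: VD.
- move=> J' qs x pJ' sJ jq; rewrite (sol _ _ x pJ' sJ jq).
  have jq1 := jt _ _ pJ' sJ jq.
  have Hx v t : J' t -> C t *m D t *m v t + \sum_(j < mu.+1) ((if nat_of_ord j is 0%N then B t
        else 0) + \sum_(l < mu) C t *m H l t *m L l j t) *m qs j t =
      C t *m (D t *m v t + \sum_(l < mu) H l t *m opjet J 2 N qs l t) +
      B t *m qs 0%N t.
    move=> J't; have Jt := sJ t J't.
    under eq_bigr do rewrite mulmxDl.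
    rewrite big_split /= (collect _ (fun l t => C t *m H l t)) //.
    rewrite big_ord_recl /= [X in _ + (_ + X + _)]big1 ?addr0; last first.
      by move=> j _; rewrite mul0mx.
    rewrite mulmxDr mulmx_sumr mulmxA -[RHS]addrA; congr (_ + _).
    rewrite addrC; congr (_ + _).
    by apply: eq_bigr => l _; rewrite mulmxA.
  split.
    move=> [z [sz ex]]; have [v [dv ez]] := (sol1 _ _ z pJ' sJ jq1).1 sz.
    exists v; split; last by move=> t Jt; rewrite ex// ez// Hx.
    by move=> t Jt; rewrite collect; [exact: dv|exact: sJ].
  move=> [v [dv ex]].
  exists (fun t => D t *m v t + \sum_(l < mu) H l t *m opjet J 2 N qs l t).
  split; last by move=> t Jt; rewrite ex// Hx.
  apply/(sol1 _ _ _ pJ' sJ jq1); exists v; split=> // t Jt.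
  by have := dv t Jt; rewrite collect //; exact: sJ.
Qed.

End Steps.
End Solvable.

(** * Comparison with the given reduction *)

Section Chain.
Variable R : realType.
Implicit Types (J : set R) (t : R).

(* The pair [{E, F}] is [{E0, F0}] after the change of variables [x0 = K x] and
   the scaling [L]; both reductions are then related in the same way, with only
   [K1] required to be differentiable. *)
Lemma reduction_transport J k (m r : nat) (E F : R -> 'M[R]_m)
    (E0 F0 L K K' : R -> 'M[R]_m) (E01 F01 : R -> 'M[R]_r)
    (Y : R -> 'M[R]_(m, r)) (Vy : R -> 'M[R]_(r, m)) (U : R -> 'M[R]_(m, m - r))
    (W : R -> 'M[R]_(m - r, m)) (C : R -> 'M[R]_(m, r))
    (Vc : R -> 'M[R]_(r, m)) (B : R -> 'M[R]_m) :
  proper_interval J -> splitting J k.+1 E F Y Vy U W C Vc B ->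
  (forall t, J t -> L t \in unitmx /\ K t \in unitmx) ->
  msmooth J 1 K -> (forall t, J t -> mderiv J K t (K' t)) ->
  (forall t, J t -> E t = L t *m E0 t *m K t /\
     F t = L t *m (F0 t *m K t + E0 t *m K' t)) ->
  reduction J E0 F0 E01 F01 ->
  exists L1 K1 K1' : R -> 'M[R]_r,
    [/\ forall t, J t -> L1 t \in unitmx /\ K1 t \in unitmx,
        msmooth J 1 K1, forall t, J t -> mderiv J K1 t (K1' t)
      & forall t, J t -> next_E E Vy C t = L1 t *m E01 t *m K1 t /\
          next_F J E F Vy C t = L1 t *m (F01 t *m K1 t + E01 t *m K1' t)].
Proof.
move=> pJ sp uLK sK dK EF /reductionP [Y0 [C0 [C0' [sC0 dC0 rd]]]].
(* The coordinates of [K C] in the basis [C0], by least squares; only [C0], [K] and [C] enter, so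
   [K1] is C^1. *)
pose K1 t := invmx ((C0 t)^T *m C0 t) *m (C0 t)^T *m (K t *m C t).
have sC1 : msmooth J 1 C by exact: msmoothW (sp_C sp).
have sK1 : msmooth J 1 K1.
  have sT : msmooth J 1 (fun t => (C0 t)^T) by exact: msmoothT.
  apply: msmoothM; last exact: msmoothM.
  apply: msmoothM => //; apply: msmooth_inv; last exact: msmoothM.
  by move=> t /rd [].
have [dK1 _] := msmooth_derive_on pJ sK1.
have [dC _] := msmooth_derive_on pJ sC1.
have KC t : J t -> K t *m C t = C0 t *m K1 t.
  move=> Jt; have [uL uK] := uLK t Jt; have [EE FE] := EF t Jt.
  have [_ _ _ uC0 _ S _ _] := rd t Jt.
  have [M YE] := sp_YE sp Jt.
  have FC : F t *m C t = E t *m (M *m (Vy t *m (F t *m C t))).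
    rewrite mulmxA -YE -[LHS]mul1mx -(sp_YU sp Jt) mulmxDl -!mulmxA.
    by rewrite [W t *m _]mulmxA (sp_WFC sp Jt) mulmx0 addr0.
  set X := M *m _ in FC.
  have [V KCV] : exists V, K t *m C t = C0 t *m V.
    (* The term with [K'] stays in [im E0], so [K] still maps [ker (W F)] into the span of [C0]
       although it varies with time. *)
    apply: (S _ _ (K t *m X - K' t *m C t)).
    have : L t *m (F0 t *m K t *m C t + E0 t *m K' t *m C t) =
        L t *m (E0 t *m K t *m X).
      by rewrite -mulmxDl mulmxA -FE FC EE !mulmxA.
    move=> /(congr1 (mulmx (invmx (L t)))); rewrite -!mulmxA !(mulKmx uL) => h.
    by rewrite mulmxBr -h addrK.
  rewrite /K1 KCV; congr (_ *m _).
  by rewrite -mulmxA (mulmxA (C0 t)^T (C0 t) V) mulKmx.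
have KC' t : J t -> K' t *m C t + K t *m derive_on J C t =
    C0' t *m K1 t + C0 t *m derive_on J K1 t.
  move=> Jt; apply: (mderiv_unique pJ Jt (mderivM (dK t Jt) (dC t Jt))).
  apply: (@eq_mderiv _ _ _ _ (fun t => C0 t *m K1 t)) => //.
    by move=> s Js; rewrite KC.
  by apply: mderivM; [exact: dC0|exact: dK1].
(* Chosen so that [L1 Y0^T = Vy L Q] with [Q] the orthogonal projector onto [im E0]. No regularity
   of [Y0] is known, and a scaling needs none. *)
pose L1 t := Vy t *m L t *m Y0 t *m invmx ((Y0 t)^T *m Y0 t).
have L1E0 t : L1 t = Vy t *m L t *m Y0 t *m invmx ((Y0 t)^T *m Y0 t) by [].
clearbody L1; exists L1, K1, (derive_on J K1); split=> //.
- move=> t Jt; have [uL uK] := uLK t Jt; have [EE FE] := EF t Jt.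
  have [uY0 _ [M Y0E] uC0 _ _ _ _] := rd t Jt; split.
    (* [L] carries [im E0] into [im E], where [Y Vy] is the identity. *)
    have PLY : L t *m Y0 t = Y t *m (Vy t *m (L t *m Y0 t)).
      have LY : L t *m Y0 t = E t *m (invmx (K t) *m M).
        by rewrite EE Y0E -!mulmxA (mulKVmx uK).
      rewrite [RHS]mulmxA -[LHS]mul1mx -(sp_YU sp Jt) mulmxDl.
      rewrite -[U t *m W t *m _]mulmxA {2}LY [W t *m _]mulmxA (sp_WE sp Jt) mul0mx.
      by rewrite mulmx0 addr0.
    rewrite L1E0 unitmx_mul unitmx_inv uY0 andbT -mulmxA.
    apply: (@mulmx1_unit _ _
      (invmx ((Y0 t)^T *m Y0 t) *m (Y0 t)^T *m invmx (L t) *m Y t) _ _).2.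
    by rewrite -!mulmxA -PLY (mulKmx uL) mulVmx.
  apply: (@mulmx1_unit _ _ (Vc t *m invmx (K t) *m C0 t) _ _).2.
  by rewrite -!mulmxA -(KC t Jt) (mulKmx uK) (sp_VcC sp Jt).
- move=> t Jt; have [EE FE] := EF t Jt.
  have [uY0 [M EY0] _ _ [W0 FC0] _ -> ->] := rd t Jt.
  pose Q := Y0 t *m invmx ((Y0 t)^T *m Y0 t) *m (Y0 t)^T.
  have QE : Q *m E0 t = E0 t by rewrite /Q EY0 -!mulmxA (mulmxA (Y0 t)^T (Y0 t) M) (mulKmx uY0).
  have QF : Q *m (F0 t *m C0 t) = F0 t *m C0 t by rewrite FC0 mulmxA QE.
  have L1E p (X : 'M[R]_(m, p)) : L1 t *m ((Y0 t)^T *m X) = Vy t *m (L t *m (Q *m X)).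
    by rewrite L1E0 /Q !mulmxA.
  split.
    by rewrite /next_E EE -!mulmxA (KC t Jt) L1E (mulmxA Q) QE.
  have -> : (Y0 t)^T *m (F0 t *m C0 t + E0 t *m C0' t) *m K1 t +
      (Y0 t)^T *m E0 t *m C0 t *m derive_on J K1 t =
      (Y0 t)^T *m (F0 t *m C0 t *m K1 t + E0 t *m (C0' t *m K1 t +
        C0 t *m derive_on J K1 t)).
    by rewrite !(mulmxDl, mulmxDr) !mulmxA addrA.
  rewrite L1E mulmxDr [Q *m (_ *m K1 t)]mulmxA QF [Q *m (E0 t *m _)]mulmxA QE.
  rewrite -(KC' t Jt) -[F0 t *m _ *m _]mulmxA -(KC t Jt).
  rewrite /next_F EE FE; congr (_ *m _).
  by rewrite !(mulmxDl, mulmxDr) !mulmxA !addrA.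
Qed.

End Chain.

Section ChainSolvable.
Variable R : realType.
Implicit Types (J : set R) (t : R).

(** The induction needs a pair merely equivalent to that of the chain, since the smooth reduction of
    [{E, F}] is equivalent, not equal, to the given next pair. *)
Lemma chain_solvable J mu k (m r : nat) (E F E0 F0 L K K' : R -> 'M[R]_m) theta :
  proper_interval J -> (mu < k)%N -> msmooth J k E -> msmooth J k F ->
  (forall t, J t -> L t \in unitmx /\ K t \in unitmx) ->
  msmooth J 1 K -> (forall t, J t -> mderiv J K t (K' t)) ->
  (forall t, J t -> E t = L t *m E0 t *m K t /\
     F t = L t *m (F0 t *m K t + E0 t *m K' t)) ->
  reduction_chain J mu E0 F0 r theta ->
  solvable_form J k E F mu (r - \sum_(j < mu.-1) theta j).
Proof.
move=> pJ; elim: mu k m r E F E0 F0 L K K' theta => // mu IH [//|k].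
move=> m r E F E0 F0 L K K' theta muk sE sF uLK sK dK EF [reg ch].
have rE t : J t -> \rank (E t) = r.
  move=> Jt; have [_ <- _] := reg t Jt; have [-> _] := EF t Jt.
  have [uL uK] := uLK t Jt.
  rewrite mxrankMfree ?row_free_unit// (rank_injr _ (mulVmx uL)) //.
have full t : J t -> forall w : 'rV_m, w *m E t = 0 -> w *m F t = 0 -> w = 0.
  move=> Jt w; have [-> ->] := EF t Jt; have [uL uK] := uLK t Jt.
  have [hfull _ _] := reg t Jt => wE wF.
  have wLE : w *m L t *m E0 t = 0.
    by move: wE; rewrite !mulmxA -{2}[w *m _ *m _](mulmxK uK) => ->; rewrite mul0mx.
  have wLF : w *m L t *m F0 t = 0.
    rewrite -[LHS](mulmxK uK); move: wF; rewrite mulmxA mulmxDr !mulmxA wLE mul0mx addr0.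
    by move=> ->; rewrite mul0mx.
  have := full_row_rows hfull wLE wLF.
  by move=> wL; rewrite -[w](mulmxK uL) wL mul0mx.
have [Y [Vy [U [W [C [Vc [B sp]]]]]]] := smooth_splitting pJ sE sF rE full.
have [sE1 sF1 _ _] := next_smooth pJ sp sE sF.
case: mu IH muk ch => [|mu] IH muk ch.
  rewrite big_ord0 subn0; apply: (solvable_form_base pJ sp sE sF).
  case: ch => [[_ [E01 [F01 [red uE01]]]]|r0].
    have [L1 [K1 [K1' [uLK1 _ _ EF1]]]] := reduction_transport pJ sp uLK sK dK EF red.
    move=> t Jt; have [-> _] := EF1 t Jt; have [uL1 uK1] := uLK1 t Jt.
    by rewrite !unitmx_mul uL1 uK1 uE01.
  (* The empty leading matrix has determinant 1, so both ways of terminating share one base case. *)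
  by move=> t Jt; subst r; rewrite unitmxE det_mx00 unitr1.
have [E01 [F01 [r1 [red r1r ch1]]]] := ch.
have [L1 [K1 [K1' [uLK1 sK1 dK1 EF1]]]] := reduction_transport pJ sp uLK sK dK EF red.
have := IH k r r1 _ _ E01 F01 L1 K1 K1' (fun i => theta i.+1) muk
  (msmoothW (leqnSn k) sE1) sF1 uLK1 sK1 dK1 EF1 ch1.
move=> /(solvable_form_step pJ sp sE sF (muk : (mu.+1 < k)%N)).
suff -> : (r1 - \sum_(j < mu.+1.-1) theta j.+1 =
    r - \sum_(j < mu.+2.-1) theta j)%N by [].
have [_ [a /interior_subset Ja]] := pJ.
have [_ _ dth] := reg a Ja.
have [reg1 _] := ch1; have [_ rE01 _] := reg1 a Ja.
have [Y0 [C0 [C0' [_ _ /(_ a Ja) rd]]]] := reductionP red.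
have := rank_step rd dth; rewrite rE01 => <-.
by rewrite /= big_ord_recl /= addnC subnDl.
Qed.

Lemma regular_solvable J mu k (m r : nat) (E F : R -> 'M[R]_m) theta :
  proper_interval J -> (mu < k)%N -> msmooth J k E -> msmooth J k F ->
  reduction_chain J mu E F r theta ->
  solvable_form J k E F mu (r - \sum_(j < mu.-1) theta j).
Proof.
move=> pJ muk sE sF.
apply: (chain_solvable (L := fun=> 1%:M) (K := fun=> 1%:M) (K' := fun=> 0)) => //.
- by move=> t _; rewrite unitmx1.
- exact: msmooth_cst.
- by move=> t _; exact: mderiv_cst.
- by move=> t _; rewrite !mul1mx !mulmx1 mulmx0 addr0.
Qed.

End ChainSolvable.

(** * Canonical subspaces and the a priori bound *)

Section Final.
Variable R : realType.
Implicit Types (J : set R) (t a b c : R).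

Lemma dsol_dae J (m : nat) (E F : R -> 'M[R]_m) (q x : R -> 'cV[R]_m) :
  proper_interval J -> dsol J E F q x <-> dae_solution J E F q x.
Proof.
move=> pJ; split=> [[x' [dx cx' ex]]|[cx ex]].
  split; first by apply: msmooth_Ck_on1 => //; exact: der_msmooth dx cx'.
  by move=> t Jt; rewrite (mderiv_derive_on pJ Jt (dx t Jt)); exact: ex.
have [dx cx'] := msmooth_derive_on pJ (Ck_on_msmooth cx).
by exists (derive_on J x).
Qed.

Lemma sub_dsol J' J (m : nat) (E F : R -> 'M[R]_m) (q x : R -> 'cV[R]_m) :
  J' `<=` J -> dsol J E F q x -> dsol J' E F q x.
Proof.
move=> sJ [x' [dx cx' ex]]; exists x'; split.
- by move=> t /sJ Jt; apply: (sub_mderiv sJ); exact: dx.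
- exact: sub_msmooth cx'.
- by move=> t /sJ; exact: ex.
Qed.

(** [t] may be an endpoint of [J]; contracting [J] towards [t] with ratio [s] moves an interior
    point of [J] into the window. *)
Lemma proper_interval_local J t (e : R) : proper_interval J -> J t -> 0 < e ->
  proper_interval (`]t - e, t + e[ `&` J).
Proof.
move=> [iJ [u0 Ju0]] Jt e0; have [u Ju] : exists u : R, nbhs u J by exists u0.
split.
  move=> x y [xe Jx] [ye Jy] z xyz; split; last exact: iJ Jx Jy _ xyz.
  exact: (@interval_is_interval _ `]t - e, t + e[ x y xe ye z xyz).
have [d /= d0 bd] := (nbhs_ballP _ _).1 Ju.
have n0 : 0 <= `|u - t| by exact: normr_ge0.
(* This value ensures both [s <= 1] and [s * |u - t| < e], also when [u = t]. *)
pose s : R := e / (2 * (e + `|u - t|)).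
have den0 : 0 < 2 * (e + `|u - t|) by lra.
have s0 : 0 < s by rewrite divr_gt0.
have s1 : s <= 1 by rewrite ler_pdivrMr// mul1r; lra.
have su : s * `|u - t| < e.
  rewrite /s mulrAC ltr_pdivrMr//; nra.
clearbody s.
exists (t + s * (u - t)); rewrite interiorI; split.
  suff : \forall y \near t + s * (u - t), y \in `]t - e, t + e[ by [].
  apply: near_in_itvoo; rewrite in_itv /=.
  move: su; rewrite -{1}(gtr0_norm s0) -normrM ltr_norml => /andP[h1 h2].
  by apply/andP; split; lra.
apply/nbhs_ballP; exists (s * d); first by rewrite /= mulr_gt0.
suff hJ (y : R) : `|t + s * (u - t) - y| < s * d -> J y by move=> y; exact: hJ.
move=> hy; pose z := t + s^-1 * (y - t).
have Jz : J z.
  apply: bd; rewrite /ball /= /z -(ltr_pM2l s0) -{1}(gtr0_norm s0) -normrM.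
  have -> : s * (u - (t + s^-1 * (y - t))) = t + s * (u - t) - y.
    by field; rewrite gt_eqF.
  exact: hy.
have yE : y = t + s * (z - t) by rewrite /z; field; rewrite gt_eqF.
move: z Jz yE => z Jz yE; clear hy.
have [tz|/ltW zt] := leP t z.
  have h1 : 0 <= s * (z - t) by rewrite mulr_ge0 ?subr_ge0// ltW.
  have h2 : 0 <= (1 - s) * (z - t) by rewrite mulr_ge0 ?subr_ge0.
  by apply: (iJ t z Jt Jz); rewrite yE; apply/andP; split; lra.
have h1 : 0 <= s * (t - z) by rewrite mulr_ge0 ?subr_ge0// ltW.
have h2 : 0 <= (1 - s) * (t - z) by rewrite mulr_ge0 ?subr_ge0.
by apply: (iJ z t Jz Jt); rewrite yE; apply/andP; split; lra.
Qed.

Lemma le_sum_norm (p q : nat) (M : 'M[R]_(p, q)) : `|M| <= sum_norm M.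
Proof.
apply: mx_norm_leP => [|i j]; first exact: sum_norm_ge0.
apply: le_trans (row_sum_norm M i); rewrite (bigD1 j) //= lerDl.
exact: sumr_ge0.
Qed.

Lemma le_max_norm J (m : nat) (f : R -> 'cV[R]_m) b c t :
  msmooth J 0 f -> [set` `[b, c]] `<=` J -> b <= t <= c ->
  `|f t| <= max_norm `[b, c] f.
Proof.
move=> cf sJ tbc; have bc : b <= c by case/andP: tbc; exact: le_trans.
have [K K0 hK] := segment_bounded bc sJ cf.
apply: sup_upper_bound; last by exists t => //=; rewrite in_itv.
split; first by exists `|f t|, t => //=; rewrite in_itv.
exists K => x [s /=]; rewrite in_itv /= => sbc <-.
exact: le_trans (le_sum_norm _) (hK s sbc).
Qed.

Lemma max_norm_le (m : nat) (f : R -> 'cV[R]_m) b c M : b <= c ->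
  (forall t, b <= t <= c -> `|f t| <= M) -> max_norm `[b, c] f <= M.
Proof.
move=> bc h; apply: ge_sup.
  by exists `|f b|, b => //=; rewrite in_itv /= lexx.
by move=> x [s /=]; rewrite in_itv /= => sbc <-; exact: h.
Qed.

Lemma family_bounded J mu (p q : nat) (B : nat -> R -> 'M[R]_(p, q)) b c :
  b <= c -> [set` `[b, c]] `<=` J -> (forall l, (l < mu)%N -> msmooth J 0 (B l)) ->
  exists2 K, 0 <= K &
    forall l t, (l < mu)%N -> b <= t <= c -> sum_norm (B l t) <= K.
Proof.
move=> bc sJ; elim: mu => [|mu IH] cB; first by exists 0.
have [K K0 hK] := IH (fun l lm => cB l (ltnW lm)).
have [K' K'0 hK'] := segment_bounded bc sJ (cB mu (ltnSn mu)).
exists (K + K') => [|l t]; first exact: addr_ge0.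
rewrite ltnS leq_eqVlt => /orP[/eqP ->|lm] tbc.
  by rewrite (le_trans (hK' t tbc))// lerDr.
by rewrite (le_trans (hK l t lm tbc))// lerDl.
Qed.

Lemma sum_bound mu (p q : nat) (B : nat -> 'M[R]_(p, q)) (w : nat -> 'cV[R]_q) K S :
  0 <= K -> (forall l, (l < mu)%N -> sum_norm (B l) <= K) ->
  (forall l, (l < mu)%N -> `|w l| <= S) ->
  `|\sum_(l < mu) B l *m w l| <= mu%:R * (K * S).
Proof.
move=> K0 hB hw; rewrite (le_trans (ler_norm_sum _ _ _))//.
have -> : mu%:R * (K * S) = \sum_(l < mu) K * S.
  by rewrite sumr_const card_ord mulr_natl.
apply: ler_sum => l _; apply: le_trans (mulmx_norm _ _) _.
apply: ler_pM => //; first exact: sum_norm_ge0.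
  exact: hB.
exact: hw.
Qed.

Lemma mulmx_norm_le (p q l : nat) (M : 'M[R]_(p, q)) (Z : 'M[R]_(q, l)) K S :
  sum_norm M <= K -> `|Z| <= S -> `|M *m Z| <= K * S.
Proof.
move=> hM hZ; apply: le_trans (mulmx_norm _ _) _.
by apply: ler_pM => //; exact: sum_norm_ge0.
Qed.

(* Uses [(Psi v)' = Psi f] for the inverse [Psi] of a fundamental matrix. *)
Lemma linear_ode_bound J (n : nat) (A : R -> 'M[R]_n) b c :
  proper_interval J -> b <= c -> [set` `[b, c]] `<=` J -> msmooth J 0 A ->
  exists2 K, 0 <= K & forall a (v f : R -> 'cV[R]_n) S, b <= a <= c ->
    (forall t, J t -> mderiv J v t (A t *m v t + f t)) -> `|v a| <= S ->
    (forall t, b <= t <= c -> `|f t| <= S) ->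
    forall t, b <= t <= c -> `|v t| <= K * S.
Proof.
move=> [iJ [a0 /interior_subset Ja0]] bc sJ cA.
(* Anchored at a fixed [a0] rather than at the initial time, so that the constant does not depend on
   [a]. *)
have [Phi [Psi [_ dPhi dPsi inv [sPhi sPsi]]]] := fundamental_pair iJ Ja0 cA.
have [KP KP0 hP] := segment_bounded bc sJ (msmoothW (leq0n 1) sPhi).
have [KQ KQ0 hQ] := segment_bounded bc sJ (msmoothW (leq0n 1) sPsi).
have cb0 : 0 <= c - b by rewrite subr_ge0.
exists (KP * (KQ + KQ * (c - b))).
  by rewrite mulr_ge0// addr_ge0// mulr_ge0.
move=> a v f S abc dv hva hf t tbc.
have S0 : 0 <= S by exact: le_trans hva.
have inJ s : b <= s <= c -> J s by move=> sbc; apply: sJ; rewrite /= in_itv.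
have seg s : [set` `[b, c]] s -> b <= s <= c by rewrite /= in_itv.
pose u s := Psi s *m v s.
have du s : J s -> mderiv J u s (Psi s *m f s).
  move=> Js; have := mderivM (dPsi s Js) (dv s Js).
  by rewrite mulmxDr mulNmx mulmxA addKr.
have hu : `|u t - u a| <= KQ * S * `|t - a|.
  apply: (@mean_value_bound R `[b, c] n 1 u (fun s => Psi s *m f s)) => //.
  - exact: interval_is_interval.
  - by rewrite mulr_ge0.
  - by move=> s /seg /inJ Js; apply: (sub_mderiv sJ); exact: du.
  - by move=> s /seg sbc; apply: mulmx_norm_le; [exact: hQ|exact: hf].
have ta : `|t - a| <= c - b.
  by move: tbc abc => /andP[? ?] /andP[? ?]; rewrite ler_norml; apply/andP; split; lra.
have ua : `|u a| <= KQ * S by apply: mulmx_norm_le => //; exact: hQ.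
have ut : `|u t| <= KQ * S + KQ * S * (c - b).
  rewrite -[u t](subrK (u a)) addrC (le_trans (ler_normD _ _))// lerD//.
  by apply: le_trans hu _; apply: ler_wpM2l => //; exact: mulr_ge0.
have -> : v t = Phi t *m u t by rewrite mulmxA (inv t (inJ t tbc)).2 mul1mx.
have -> : KP * (KQ + KQ * (c - b)) * S = KP * (KQ * S + KQ * S * (c - b)) by ring.
by apply: mulmx_norm_le => //; exact: hP.
Qed.

Lemma linear_ode_unique J (n : nat) (A : R -> 'M[R]_n) (f v w : R -> 'cV[R]_n) a :
  is_interval J -> J a -> msmooth J 0 A ->
  (forall t, J t -> mderiv J v t (A t *m v t + f t)) ->
  (forall t, J t -> mderiv J w t (A t *m w t + f t)) -> v a = w a ->
  forall t, J t -> v t = w t.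
Proof.
move=> iJ Ja cA dv dw vw t Jt.
have [Phi [Psi [_ _ dPsi inv _]]] := fundamental_pair iJ Ja cA.
have e : Psi t *m (v t - w t) = Psi a *m (v a - w a).
  apply: (@mderiv0_cst R J n 1 (fun s => Psi s *m (v s - w s))) => // s Js.
  have := mderivM (dPsi s Js) (mderivB (dv s Js) (dw s Js)).
  rewrite [X in mderiv _ _ _ X](_ : _ = 0)//.
  by rewrite opprD addrACA subrr addr0 -mulmxBr mulNmx mulmxA addNr.
apply/eqP; rewrite -subr_eq0; apply/eqP.
by rewrite -[LHS]mul1mx -(inv t Jt).2 -mulmxA e vw subrr !mulmx0.
Qed.

Section Projector.
Variables (m d : nat) (D : 'M[R]_(m, d)) (V : 'M[R]_(d, m)).
Hypothesis VD : V *m D = 1%:M.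

(** The Moore-Penrose inverse of [D]: a left inverse with the same kernel as [D^T]. *)
Definition orth_coord := invmx (D^T *m D) *m D^T.
Definition orth_proj := D *m orth_coord.

Lemma orth_coordK : orth_coord *m D = 1%:M.
Proof. by rewrite /orth_coord -mulmxA mulVmx// gram_unit//; exact: inj_of_linv VD. Qed.

Lemma trmx_orth_coord p (x : 'M[R]_(m, p)) : D^T *m x = 0 <-> orth_coord *m x = 0.
Proof.
have uD : D^T *m D \in unitmx by apply: gram_unit; exact: inj_of_linv VD.
rewrite /orth_coord -mulmxA; split=> [->|h]; first by rewrite mulmx0.
by rewrite -[LHS](mulKVmx uD) h mulmx0.
Qed.

Lemma orth_decomposition :
  [/\ \dim (ker_mx D^T) = (m - d)%N, (im_mx D + ker_mx D^T)%VS = fullv,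
      (im_mx D :&: ker_mx D^T)%VS = 0%VS
    & unique (projector_onto_along (im_mx D) (ker_mx D^T)) orth_proj].
Proof.
have cD := orth_coordK.
have kerP (x : 'cV[R]_m) : x \in ker_mx D^T <-> orth_coord *m x = 0.
  by rewrite mem_ker_mx; exact: trmx_orth_coord.
have PD : orth_proj *m D = D by rewrite /orth_proj -mulmxA cD mulmx1.
split.
- have := limg_ker_dim (linfun (mulmx D^T : 'cV[R]_m -> 'cV[R]_d)) fullv.
  rewrite capfv dimvf dim_matrix mulr1 -[(_ @: fullv)%VS]/(im_mx D^T) dim_im_mx.
  rewrite mxrank_tr -dim_im_mx dim_im_inj; last exact: inj_of_linv VD.
  by move=> /(congr1 (subn^~ d)) /=; rewrite addnK.
- apply/eqP; rewrite eqEsubv subvf /=; apply/subvP => x _.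
  apply/memv_addP; exists (orth_proj *m x).
    by apply/mem_im_mx; exists (orth_coord *m x); rewrite mulmxA.
  exists (x - orth_proj *m x); last by rewrite addrC subrK.
  by apply/kerP; rewrite mulmxBr mulmxA /orth_proj mulmxA cD mul1mx subrr.
- apply/eqP; rewrite -subv0; apply/subvP => x; rewrite memv_cap memv0.
  move=> /andP[/mem_im_mx [w ->] /kerP]; rewrite mulmxA cD mul1mx => ->.
  by rewrite mulmx0.
- split; first split.
  + by rewrite {1}/orth_proj -mulmxA [orth_coord *m _]mulmxA cD mul1mx.
  + exact: (eq_im_mx (U := orth_coord) (V := D) _ (esym PD)).
  + apply/vspaceP => x; apply/idP/idP.
      move=> /mem_ker_mx h; apply/kerP.
      suff -> : orth_coord *m x = orth_coord *m (orth_proj *m x) by rewrite h mulmx0.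
      by rewrite /orth_proj -(mulmxA D) (mulmxA orth_coord D) cD mul1mx.
    by move=> /kerP h; apply/mem_ker_mx; rewrite -mulmxA h mulmx0.
  (* Uniqueness: [P] is the identity on [im D] and kills the range of [1 - orth_proj], so it equals
     [orth_proj]. *)
  + move=> P [PP imP kerPE].
    have PDD : P *m D = D.
      have [X DX] : exists X, D = P *m X.
        apply: lift_cols => w; apply/mem_im_mx; rewrite imP; apply/mem_im_mx.
        by exists w.
      by rewrite DX mulmxA PP.
    have P1 : P *m (1%:M - orth_proj) = 0.
      apply/matrixP => i j; rewrite [RHS]mxE.
      have h : (1%:M - orth_proj) *m delta_mx j (0 : 'I_1) \in ker_mx P.
        rewrite kerPE; apply/kerP.
        by rewrite mulmxA mulmxBr mulmx1 /orth_proj mulmxA cD mul1mx subrr mul0mx.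
      move/mem_ker_mx: h; rewrite mulmxA -colE.
      by move=> /(congr1 (fun M : 'cV[R]_m => M i 0)); rewrite !mxE.
    by move: P1 => /eqP; rewrite mulmxBr mulmx1 subr_eq0 /orth_proj mulmxA PDD => /eqP.
Qed.

End Projector.
End Final.

(** * The canonical flow subspace and the theorem *)

Section CanonicalFlow.
Variable R : realType.
Implicit Types (J : set R) (t a b c : R).

Lemma zero_jet J k (m : nat) : jet J k (fun (_ : nat) (_ : R) => 0 : 'cV[R]_m).
Proof. by split=> [l _ t _|l _]; [exact: mderiv_cst|exact: msmooth_cst]. Qed.

(** Any [w] is the value of a global solution [v] of the inherent equation, restricted to a window;
    conversely the formula applied on the window itself shows that a local solution is [D v]. *)
Lemma canonical_flow_im J k (m : nat) (E F : R -> 'M[R]_m) mu d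
    (D : R -> 'M[R]_(m, d)) (V : R -> 'M[R]_(d, m)) (A : R -> 'M[R]_d)
    (H : nat -> R -> 'M[R]_m) (B : nat -> R -> 'M[R]_(d, m)) t :
  proper_interval J -> msmooth J 0 A ->
  (forall J' qs x, proper_interval J' -> J' `<=` J -> jet J' k qs ->
    dsol J' E F (qs 0%N) x <-> exists v,
      (forall t, J' t -> mderiv J' v t (A t *m v t + \sum_(l < mu) B l t *m qs l t))
      /\ forall t, J' t -> x t = D t *m v t + \sum_(l < mu) H l t *m qs l t) ->
  J t -> [set` im_mx (D t)] = canonical_flow J E F t.
Proof.
move=> pJ cA sol Jt.
have z0 p (M : nat -> R -> 'M[R]_(p, m)) s :
    \sum_(l < mu) M l s *m (0 : 'cV[R]_m) = 0.
  by rewrite big1// => l _; rewrite mulmx0.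
apply/seteqP; split=> [x0 /= /mem_im_mx [w ->]|x0 /= [e e0 [x sx <-]]].
  have [v [vt dv]] := linear_ode_solution w pJ.1 Jt cA (msmooth_cst J 0 (0 : 'cV[R]_d)).
  have pJ' := proper_interval_local pJ Jt ltr01.
  exists 1 => //; exists (fun s => D s *m v s); last by rewrite vt.
  apply/(dsol_dae _ _ _ _ pJ'); apply: (sub_dsol (J := J)); first exact: subIsetr.
  apply/(sol J (fun _ _ => 0) _ pJ (fun s => id) (zero_jet _ _ _)).
  exists v; split=> s Js; rewrite z0 ?addr0//.
  by have := dv s Js; rewrite addr0.
have pJ' := proper_interval_local pJ Jt e0.
have /(dsol_dae _ _ _ _ pJ') := sx.
move=> /(sol _ (fun _ _ => 0) _ pJ' (@subIsetr _ _ _) (zero_jet _ _ _)).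
move=> [v [dv ex]]; apply/mem_im_mx; exists (v t); rewrite ex ?z0 ?addr0//.
split=> //=; rewrite in_itv /=; apply/andP; split; lra.
Qed.

End CanonicalFlow.

Theorem theorem5p1 (R : realType) (m : nat) :
  (* k is the order of differentiability meant by "sufficiently smooth" *)
  exists k : nat,
  forall (J : set R) (E F : R -> 'M[R]_m) (mu r : nat) (theta : nat -> nat),
  proper_interval J ->
  Ck_on J k E -> Ck_on J k F ->
  regular_pair J E F mu r theta ->
  (forall i j, (i <= j < mu)%N -> (theta j <= theta i)%N) ->
  (forall i, (i.+1 < mu)%N -> (0 < theta i)%N) ->
  theta mu.-1 = 0%N ->
  let d := (r - \sum_(j < mu.-1) theta j)%N in
  exists (Scan Ncan : R -> {vspace 'cV[R]_m}) (Pican : R -> 'M[R]_m)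
         (K : R -> R -> R),
  (forall t, J t -> [set` Scan t] = canonical_flow J E F t) /\
  (forall t, J t ->
     [/\ \dim (Ncan t) = (m - d)%N,
         \dim (Ncan t) = (m - r + \sum_(j < mu.-1) theta j)%N,
         (Scan t + Ncan t)%VS = fullv,
         (Scan t :&: Ncan t)%VS = 0%VS
       & unique (projector_onto_along (Scan t) (Ncan t)) (Pican t)]) /\
  (forall (a : R) (s : nat) (Ga : 'M[R]_(s, m)) (q : R -> 'cV[R]_m)
          (xa : 'cV[R]_m),
     J a -> (d <= s)%N -> ker_mx Ga = Ncan a -> Ck_on J k q ->
     exists x : R -> 'cV[R]_m,
       [/\ dae_solution J E F q x /\ Ga *m (x a - xa) = 0,
           forall y : R -> 'cV[R]_m,
             dae_solution J E F q y -> Ga *m (y a - xa) = 0 ->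
             forall t, J t -> y t = x t,
           Pican a *m x a = Pican a *m xa
         & forall b c : R, b < c -> `[b, c] `<=` J -> a \in `[b, c] ->
             max_norm `[b, c] x <=
               K b c * (`|Pican a *m xa| + max_norm `[b, c] q
                 + \sum_(1 <= l < mu) max_norm `[b, c] (deriven_on J l q))]).
Proof.
exists m.+1 => J E F mu r theta pJ cE cF [rm ch] _ _ _ d.
have [iJ [a0 /interior_subset Ja0]] := pJ.
have [hsum hmu] := reduction_chain_bounds Ja0 ch.
have muk : (mu < m.+1)%N by rewrite ltnS; exact: leq_trans hmu rm.
have mu0 : (0 < mu)%N by case: (mu) ch.
have [D [V [A [H [B [[sD sV cA] sHB VD sol]]]]]] :=
  regular_solvable pJ muk (Ck_on_msmooth cE) (Ck_on_msmooth cF) ch.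
rewrite -/d in D V A H B sD sV cA sHB VD sol.
have cG : msmooth J 0 (fun t => orth_coord (D t)).
  have cD := msmoothW (leq0n 1) sD.
  apply: msmoothM; last exact: msmoothT.
  apply: msmooth_inv; last by apply: msmoothM => //; exact: msmoothT.
  by move=> t Jt; apply: gram_unit; exact: inj_of_linv (VD t Jt).
pose S b c (a : R) (q : R -> 'cV[R]_m) (xa : 'cV[R]_m) :=
  `|orth_proj (D a) *m xa| + max_norm `[b, c] q
    + \sum_(1 <= l < mu) max_norm `[b, c] (deriven_on J l q).
(* The constant must be a function of the segment, fixed before [a], [q] and [xa]; the value 0
   serves pairs that are not segments in [J]. *)
have /choice [K hK] : forall bc : R * R, exists K, bc.1 < bc.2 ->
    [set` `[bc.1, bc.2]] `<=` J -> forall a q xa v, bc.1 <= a <= bc.2 ->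
    Ck_on J m.+1 q ->
    v a = orth_coord (D a) *m (xa - \sum_(l < mu) H l a *m deriven_on J l q a) ->
    (forall t, J t -> mderiv J v t
      (A t *m v t + \sum_(l < mu) B l t *m deriven_on J l q t)) ->
    max_norm `[bc.1, bc.2] (fun t => D t *m v t +
      \sum_(l < mu) H l t *m deriven_on J l q t) <= K * S bc.1 bc.2 a q xa.
  move=> [b c] /=.
  have [[bc sJ]|n] := pselect (b < c /\ [set` `[b, c]] `<=` J); last first.
    by exists 0 => bc sJ; case: n.
  have bc' := ltW bc.
  have [KG KG0 hG] := segment_bounded bc' sJ cG.
  have [KD KD0 hD] := segment_bounded bc' sJ (msmoothW (leq0n 1) sD).
  have [KH KH0 hH] := family_bounded bc' sJ
    (fun l lm => msmoothW (leq0n 1) (sHB l lm).1).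
  have [KB KB0 hB] := family_bounded bc' sJ (fun l lm => (sHB l lm).2).
  have [KL KL0 hL] := linear_ode_bound pJ bc' sJ cA.
  pose nu : R := mu%:R; have nu0 : 0 <= nu by exact: ler0n.
  (* The first summand bounds the initial value [v a], the second the forcing term, both relative to
     [T]. *)
  pose M := KG * (1 + nu * KH) + nu * KB.
  exists (KD * (KL * M) + nu * KH) => _ _ a q xa v abc cq va dv.
  have Ja : J a by apply: sJ; rewrite /= in_itv.
  have cqs l : (l < mu)%N -> msmooth J 0 (deriven_on J l q).
    by move=> lm; apply/mcont_within; apply: cq.2; exact: ltnW (ltn_trans lm muk).
  have qn l t : (l < mu)%N -> b <= t <= c ->
      `|deriven_on J l q t| <= max_norm `[b, c] (deriven_on J l q).
    by move=> lm tbc; apply: le_max_norm (cqs l lm) sJ tbc.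
  have mn0 l : (l < mu)%N -> 0 <= max_norm `[b, c] (deriven_on J l q).
    by move=> lm; apply: le_trans (qn l a lm abc).
  have sum0 : 0 <= \sum_(1 <= l < mu) max_norm `[b, c] (deriven_on J l q).
    by rewrite big_nat; apply: sumr_ge0 => l /andP[_ lm]; exact: mn0.
  have q0 : 0 <= max_norm `[b, c] q := mn0 0%N mu0.
  set T := S b c a q xa.
  have qS l t : (l < mu)%N -> b <= t <= c -> `|deriven_on J l q t| <= T.
    move=> lm tbc; apply: le_trans (qn l t lm tbc) _; rewrite /T /S.
    case: l lm => [|l] lm.
      by rewrite -addrA addrCA lerDl addr_ge0.
    rewrite (bigD1_seq l.+1) /= ?iota_uniq ?mem_index_iota ?lm//.
    rewrite addrCA lerDl !addr_ge0// big_nat_cond.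
    by apply: sumr_ge0 => j /andP[/andP[_ jm] _]; exact: mn0.
  have piS : `|orth_proj (D a) *m xa| <= T by rewrite /T /S -addrA lerDl addr_ge0.
  have T0 : 0 <= T by exact: le_trans piS.
  have Hn t : b <= t <= c ->
      `|\sum_(l < mu) H l t *m deriven_on J l q t| <= nu * (KH * T).
    move=> tbc; apply: (@sum_bound _ mu _ _ (fun l => H l t)
      (fun l => deriven_on J l q t)) => // l lm; [exact: hH|exact: qS].
  have Bn t : b <= t <= c ->
      `|\sum_(l < mu) B l t *m deriven_on J l q t| <= nu * (KB * T).
    move=> tbc; apply: (@sum_bound _ mu _ _ (fun l => B l t)
      (fun l => deriven_on J l q t)) => // l lm; [exact: hB|exact: qS].
  (* This replaces [xa] by its projection, the only part of [xa] allowed in the estimate. *)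
  have GE : orth_coord (D a) *m xa = orth_coord (D a) *m (orth_proj (D a) *m xa).
    by rewrite /orth_proj -(mulmxA (D a)) (mulmxA (orth_coord (D a)) (D a))
      (orth_coordK (VD a Ja)) mul1mx.
  have va1 : `|v a| <= KG * (T + nu * (KH * T)).
    rewrite va mulmxBr GE -mulmxBr; apply: mulmx_norm_le; first exact: hG.
    by rewrite (le_trans (ler_normB _ _))// lerD// Hn.
  have vn t : b <= t <= c -> `|v t| <= KL * (M * T).
    have e1 : KG * (T + nu * (KH * T)) = KG * (1 + nu * KH) * T by ring.
    have MT : M * T = KG * (1 + nu * KH) * T + nu * (KB * T) by rewrite /M; ring.
    apply: (hL a v _ (M * T) abc dv).
      rewrite MT (le_trans va1)// e1 lerDl.
      by rewrite !mulr_ge0.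
    move=> s sbc; rewrite MT (le_trans (Bn s sbc))// lerDr.
    by rewrite !mulr_ge0 ?addr_ge0 ?mulr_ge0.
  apply: max_norm_le => // t tbc.
  rewrite (le_trans (ler_normD _ _))//.
  have -> : (KD * (KL * M) + nu * KH) * T = KD * (KL * (M * T)) + nu * (KH * T).
    by ring.
  by rewrite lerD ?Hn// mulmx_norm_le ?hD// vn.
exists (fun t => im_mx (D t)), (fun t => ker_mx (D t)^T), (fun t => orth_proj (D t)),
  (fun b c => K (b, c)); split; [|split].
- by move=> t Jt; exact: canonical_flow_im pJ cA sol Jt.
- move=> t Jt; have [h1 h2 h3 h4] := orth_decomposition (VD t Jt).
  split=> //; rewrite h1 /d; lia.
move=> a s Ga q xa Ja _ kerG cq.
have jq : jet J m.+1 (fun l => deriven_on J l q).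
  split; first exact: Ck_on_mderiv cq.
  by move=> l lk; apply/mcont_within; exact: cq.2.
pose h t := \sum_(l < mu) H l t *m deriven_on J l q t.
pose f t := \sum_(l < mu) B l t *m deriven_on J l q t.
have cf : msmooth J 0 f.
  apply: msmooth_sum => l _; apply: msmoothM; first exact: (sHB l (ltn_ord l)).2.
  by apply: jq.2; exact: ltnW (ltn_trans (ltn_ord l) muk).
(* Solving [orth_coord (x a - xa) = 0] for [v a], with [x a = D v a + h a]. *)
have [v [va dv]] := linear_ode_solution (orth_coord (D a) *m (xa - h a)) iJ Ja cA cf.
(* The two matrices have the same kernel, [N_can a], so the initial condition prescribes exactly
   [v a]. *)
have GaP (y : 'cV[R]_m) : Ga *m (y - xa) = 0 <-> orth_coord (D a) *m (y - xa) = 0.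
  rewrite -(trmx_orth_coord (VD a Ja)) -mem_ker_mx kerG mem_ker_mx.
  by [].
have cK := orth_coordK (VD a Ja).
pose x t := D t *m v t + h t.
have xaE : orth_coord (D a) *m (x a - xa) = 0.
  rewrite /x va mulmxBr mulmxDr mulmxA cK mul1mx mulmxBr subrK subrr//.
exists x; split.
- split; last exact/GaP.
  apply/(dsol_dae _ _ _ _ pJ)/(sol J _ _ pJ (fun s => id) jq).
  by exists v.
- move=> y /(dsol_dae _ _ _ _ pJ) /(sol J _ _ pJ (fun s => id) jq) [w [dw ey]].
  move=> /GaP; rewrite ey// mulmxBr mulmxDr mulmxA cK mul1mx => wa t Jt.
  rewrite ey// /x; congr (_ *m _ + _).
  apply: (linear_ode_unique iJ Ja cA dw dv _ Jt); rewrite va mulmxBr.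
  by move: wa => /eqP; rewrite subr_eq0 => /eqP <-; rewrite addrK.
- apply/eqP; rewrite -subr_eq0 -mulmxBr /orth_proj -mulmxA xaE mulmx0//.
- move=> b c bc sJ abc; apply: (hK (b, c)) => //.
Qed.
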